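(* Let $L$ and $L'$ be classical links. Then $Q_{\mathrm{tc}}(L)\cong Q_{\mathrm{tc}}(L')$ if and only if both of the following conditions hold. (a) $L$ and $L'$ have the same number of components. (b) The components of $L$ and $L'$ can be indexed (as $L=K_1\cup\dots\cup K_\mu$, $L'=K'_1\cup\dots\cup K'_\mu$) in such a way that for each connected component $C$ of the linking graph $\ell g(L)$, there is an $\epsilon_C\in\{-1,1\}$ such that $\ell(K_i,K_j)=\epsilon_C\,\ell(K'_i,K'_j)$ whenever $v_i$ is a vertex of $C$.
   Context: Quandles. A quandle is a set $Q$ with a binary operation $\triangleright$ such that: $x\triangleright x=x$ for all $x$; for each $y\in Q$ the map $\beta_y(x)=x\triangleright y$ is a bijection $Q\to Q$ (a translation); and $(w\triangleright x)\triangleright y=(w\triangleright y)\triangleright(x\triangleright y)$ for all $w,x,y$. A quandle map is a function $f$ with $f(x\triangleright y)=f(x)\triangleright f(y)$; a bijective quandle map is an isomorphism, and $\cong$ denotes isomorphism of quandles. A quandle is translation-commutative if the group generated by its translations is commutative, equivalently $(x\triangleright y)\triangleright z=(x\triangleright z)\triangleright y$ for all $x,y,z$. The translation-commutative quotient $Q_{\mathrm{tc}}$ of a quandle $Q$ is the quandle presented by a generator $x_q$ for each $q\in Q$, relations $x_{p\triangleright q}=x_p\triangleright x_q$ for all $p,q\in Q$, and relations $(x_p\triangleright x_q)\triangleright x_r=(x_p\triangleright x_r)\triangleright x_q$ for all $p,q,r\in Q$. Links. A link diagram $D$ is an oriented virtual link diagram in $\mathbb R^2$: it is obtained from a finite union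 of $\mu$ oriented piecewise smooth closed curves in general position (finitely many, transverse, double-point intersections and self-intersections, called crossings), each crossing being designated classical (with over/under information) or virtual; $D$ is classical if no crossing is virtual. At each classical crossing a short piece of the underpassing segment is removed on each side of the crossing; virtual crossings are circled and nothing is removed there. This cuts the curves into arcs; $A(D)$ is the set of arcs. Two diagrams are equivalent if related by a finite sequence of detour moves (affecting only virtual crossings) and classical Reidemeister moves (affecting only classical crossings); an equivalence class represents a link $L=K_1\cup\dots\cup K_\mu$ with components $K_i$ given by the closed curves. A classical link is one represented by a classical diagram (equivalently, an oriented link in $\mathbb S^3$). Writhe and linking numbers. At a classical crossing $c$, the writhe $w(c)$ is $+1$ if, looking along the direction of the overpassing segment, the underpassing segment crosses from right to left, and $-1$ if it crosses from left to right. For $i\ne j$, let $C_{j/i}(D)$ be the set of classical crossings at which $K_j$ passes over $K_i$; the linking number of $K_j$ over $K_i$ is $\ell_{j/i}(K_i,K_j)=\sum_{c\in C_{j/i}(D)}w(c)$, a link invariant. For classical links $\ell_{i/j}(K_i,K_j)=\ell_{j/i}(K_i,K_j)$ always, and this common value is written $\ell(K_i,K_j)=\ell(K_j,K_i)$. Linking numbers are defined only for pairs with $i\neq j$. Linking graph. $\ell g(L)$ is the simple graph with a vertex $v_i$ for each component $K_i$ such that $\ell_{j/i}(K_i,K_j)\ne0$ or $\ell_{i/j}(K_i,K_j)\neq0$ for some $j\ne i$; two vertices $v_i,v_j$ are adjacent if $i\ne j$ and $\ell_{j/i}(K_i,K_j)\neq0$ or $\ell_{i/j}(K_i,K_j)\ne0$.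 (It may have fewer than $\mu$ vertices, and may be empty.) A connected component of a graph is an equivalence class of vertices under the equivalence relation generated by adjacency. Link quandle. If $D$ is a diagram of $L$, $Q(L)$ is the quandle generated by $\{q_a\mid a\in A(D)\}$ subject to the relation $q_{a_3}=q_{a_2}\triangleright q_{a_1}$ at each classical crossing, where $a_1$ is the overpassing arc, and $a_2$ (resp. $a_3$) is the underpassing arc on the right (resp. left) of $a_1$ with respect to the orientation of $a_1$. It is a link invariant up to isomorphism. $Q_{\mathrm{tc}}(L)$ denotes the translation-commutative quotient $Q(L)_{\mathrm{tc}}$ of $Q(L)$.
   Formalization: Condition (b) also requires ℓ(K_i,K_j)=ℓ(K'_i,K'_j) for all j≠i whenever v_i is not a vertex of ℓg(L); without this the 2-component unlink and the Hopf link satisfy (a) and (b) although their Q_tc are not isomorphic. *)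

(* Defs.v *)
From mathcomp Require Import all_boot all_order all_algebra.
From mathcomp Require Import all_classical all_reals all_analysis.
Import numFieldNormedType.Exports.

Set Implicit Arguments.
Unset Strict Implicit.
Unset Printing Implicit Defensive.

Import Order.TTheory GRing.Theory Num.Theory.
Local Open Scope classical_set_scope.
Local Open Scope ring_scope.
Local Open Scope quotient_scope.

Record quandle := Quandle {
  qcarrier :> Type;
  qop : qcarrier -> qcarrier -> qcarrier;
  qop_idem : forall x, qop x x = x;
  qop_bij : forall y, bijective (fun x => qop x y);
  qop_dist : forall w x y, qop (qop w x) y = qop (qop w y) (qop x y)
}.

Definition quandle_map (Q Q' : quandle) (f : Q -> Q') : Prop :=
  forall x y, f (qop x y) = qop (f x) (f y).

Definition quandle_iso (Q Q' : quandle) : Prop :=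
  exists f : Q -> Q', quandle_map f /\ bijective f.

(* [TInv a b] stands for the preimage of [a] under the translation of [b]:   *)
(* a quandle generated by a set is closed under inverse translations too.    *)
Inductive qterm (X : Type) :=
  | TGen of X
  | TOp of qterm X & qterm X
  | TInv of qterm X & qterm X.

(* The equations between terms that follow from the quandle axioms and the   *)
(* relations [E].                                                            *)
Inductive qeq (X : Type) (E : qterm X -> qterm X -> Prop) :
    qterm X -> qterm X -> Prop :=
  | qeq_rel a b : E a b -> qeq E a b
  | qeq_refl a : qeq E a a
  | qeq_sym a b : qeq E a b -> qeq E b a
  | qeq_trans a b c : qeq E a b -> qeq E b c -> qeq E a c
  | qeq_op a a' b b' : qeq E a a' -> qeq E b b' -> qeq E (TOp a b) (TOp a' b')
  | qeq_inv a a' b b' :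
      qeq E a a' -> qeq E b b' -> qeq E (TInv a b) (TInv a' b')
  | qeq_idem a : qeq E (TOp a a) a
  | qeq_invK a b : qeq E (TInv (TOp a b) b) a
  | qeq_opK a b : qeq E (TOp (TInv a b) b) a
  | qeq_dist a b c :
      qeq E (TOp (TOp a b) c) (TOp (TOp a c) (TOp b c)).

Section Presented.
Variables (X : Type) (E : qterm X -> qterm X -> Prop).

Definition qeqb : rel {classic qterm X} := fun a b => `[< qeq E a b >].

Lemma qeqb_refl : reflexive qeqb.
Proof. by move=> a; apply/asboolP; apply: qeq_refl. Qed.

Lemma qeqb_sym : symmetric qeqb.
Proof. by move=> a b; apply/asboolP/asboolP => ?; apply: qeq_sym. Qed.

Lemma qeqb_trans : transitive qeqb.
Proof.
move=> b a c /asboolP ab /asboolP bc; apply/asboolP.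
exact: qeq_trans ab bc.
Qed.

Canonical qeqb_equiv := EquivRel qeqb qeqb_refl qeqb_sym qeqb_trans.

Definition presented_carrier := {eq_quot qeqb}.

Definition presented_class (a : qterm X) : presented_carrier :=
  \pi_presented_carrier (a : {classic qterm X}).

Definition presented_op (A B : presented_carrier) : presented_carrier :=
  presented_class (TOp (repr A) (repr B)).

Definition presented_inv (A B : presented_carrier) : presented_carrier :=
  presented_class (TInv (repr A) (repr B)).

Lemma presented_classP a b :
  presented_class a = presented_class b <-> qeq E a b.
Proof.
split=> [/eqmodP /asboolP //|ab].
by apply/eqmodP; apply/asboolP.
Qed.

Lemma presented_reprK A : presented_class (repr A) = A.
Proof. exact: reprK. Qed.

Lemma repr_presented a : qeq E (repr (presented_class a)) a.
Proof. by apply/presented_classP; rewrite presented_reprK. Qed.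

Lemma presented_opE a b :
  presented_op (presented_class a) (presented_class b)
  = presented_class (TOp a b).
Proof. by apply/presented_classP; apply: qeq_op; apply: repr_presented. Qed.

Lemma presented_invE a b :
  presented_inv (presented_class a) (presented_class b)
  = presented_class (TInv a b).
Proof. by apply/presented_classP; apply: qeq_inv; apply: repr_presented. Qed.

Lemma presented_idem A : presented_op A A = A.
Proof.
rewrite -(presented_reprK A) presented_opE.
by apply/presented_classP; apply: qeq_idem.
Qed.

Lemma presented_bij B : bijective (fun A => presented_op A B).
Proof.
exists (fun A => presented_inv A B) => A;
  rewrite -(presented_reprK A) -(presented_reprK B)
          ?(presented_opE, presented_invE);
  apply/presented_classP; [exact: qeq_invK | exact: qeq_opK].
Qed.

Lemma presented_dist A B C :
  presented_op (presented_op A B) C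
  = presented_op (presented_op A C) (presented_op B C).
Proof.
rewrite -(presented_reprK A) -(presented_reprK B) -(presented_reprK C).
by rewrite !presented_opE; apply/presented_classP; apply: qeq_dist.
Qed.

Definition presented_quandle : quandle :=
  Quandle presented_idem presented_bij presented_dist.

End Presented.

Inductive tc_relation (Q : quandle) : qterm Q -> qterm Q -> Prop :=
  | tc_mul (p q : Q) :
      tc_relation (TGen (qop p q)) (TOp (TGen p) (TGen q))
  | tc_comm (p q r : Q) :
      tc_relation (TOp (TOp (TGen p) (TGen q)) (TGen r))
                  (TOp (TOp (TGen p) (TGen r)) (TGen q)).

Definition tc_quotient (Q : quandle) : quandle :=
  presented_quandle (@tc_relation Q).

Section Diagrams.
Variable R : realType.

Definition smooth (f : R -> R) : Prop :=
  forall (n : nat) (t : R), derivable (derive1n n f) t 1.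

(* A closed curve is parametrized by the whole line with period 1.  The      *)
(* breakpoints are 0 :: s, where s ends in 1; on each closed piece it is     *)
(* the restriction of a smooth map whose velocity vanishes nowhere there.    *)
Definition piecewise_smooth_closed (g : R -> R * R) : Prop :=
  (forall t, g (t + 1) = g t) /\
  exists s : seq R, [/\ path <%R 0 s, last 0 s = 1 &
    forall k, (k < size s)%N -> exists x y : R -> R,
      [/\ smooth x, smooth y &
        forall t, nth 0 (0 :: s) k <= t <= nth 0 s k ->
          g t = (x t, y t) /\ (derive1 x t, derive1 y t) != (0, 0)]].

Section Strands.
Variables (m : nat) (g : 'I_m -> R -> R * R).

(* (i, t) is a position along the i-th curve.  The range of [t] is not       *)
(* restricted: (i, t) and (i, t + 1) are the same position.                  *)
Definition position := ('I_m * R)%type.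

Definition place (p : position) : R * R := g p.1 p.2.

Definition velocity (p : position) : R * R :=
  (derive1 (fun t => (g p.1 t).1) p.2, derive1 (fun t => (g p.1 t).2) p.2).

Definition has_velocity (p : position) : Prop :=
  derivable (fun t => (g p.1 t).1) p.2 1 /\
  derivable (fun t => (g p.1 t).2) p.2 1.

(* Positive iff [v] points to the left of [u].                               *)
Definition cross_product (u v : R * R) : R := u.1 * v.2 - u.2 * v.1.

Definition transverse (p q : position) : Prop :=
  [/\ has_velocity p, has_velocity q &
      cross_product (velocity p) (velocity q) != 0].

End Strands.

(* A crossing is given by the two positions that meet there, with the        *)
(* parameters normalized to [0, 1[: the overpassing one first if it is       *)
(* classical, and in either order if it is virtual.  By the [uniq] field no  *)
(* position belongs to two crossings, so that crossings are double points    *)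
(* and are listed once.                                                      *)
Record diagram := Diagram {
  ncomp : nat;
  curve : 'I_ncomp -> R -> R * R;
  classical_crossings : seq (position ncomp * position ncomp);
  virtual_crossings : seq (position ncomp * position ncomp);
  curve_smooth : forall i, piecewise_smooth_closed (curve i);
  crossings_uniq :
    uniq (flatten [seq [:: c.1; c.2]
                  | c <- classical_crossings ++ virtual_crossings]);
  crossings_complete : forall p q : position ncomp,
    [/\ 0 <= p.2 < 1, 0 <= q.2 < 1, p != q & place curve p = place curve q]
    <-> (p, q) \in classical_crossings ++ virtual_crossings \/
        (q, p) \in classical_crossings ++ virtual_crossings;
  crossings_transverse : forall c,
    c \in classical_crossings ++ virtual_crossings ->
    transverse curve c.1 c.2
}.

Definition is_classical (D : diagram) : Prop := virtual_crossings D = [::].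

Section DiagramTheory.
Variable D : diagram.

Local Notation pos := (position (ncomp D)).
Local Notation crossing := (pos * pos)%type.

(* The underpassing segment crosses from right to left iff its velocity      *)
(* points to the left of the velocity of the overpassing segment.            *)
Definition writhe (c : crossing) : int :=
  if 0 < cross_product (velocity (@curve D) c.1) (velocity (@curve D) c.2)
  then 1 else -1.

(* The linking number of the j-th component over the i-th one; it is only    *)
(* meaningful for i != j.                                                    *)
Definition linking_over (j i : 'I_(ncomp D)) : int :=
  \sum_(c <- classical_crossings D | (c.1.1 == j) && (c.2.1 == i)) writhe c.

(* For classical diagrams this is symmetric in i and j.                      *)
Definition linking (i j : 'I_(ncomp D)) : int := linking_over j i.

Definition lg_adj : rel 'I_(ncomp D) := fun i j =>
  (i != j) && ((linking_over j i != 0) || (linking_over i j != 0)).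

(* Only the components with some nonzero linking number are vertices.        *)
Definition lg_vertices : {set 'I_(ncomp D)} :=
  [set i | [exists j, lg_adj i j]]%SET.

Definition lg_components : {set {set 'I_(ncomp D)}} :=
  equivalence_partition (connect lg_adj) lg_vertices.

Definition underpass (p : pos) : Prop :=
  exists c : crossing, [/\ c \in classical_crossings D, c.2.1 = p.1 &
                           p.2 - c.2.2 \is a Num.int].

Definition same_arc (p q : pos) : Prop :=
  p.1 = q.1 /\
  exists n : int, forall u : R,
    Num.min p.2 (q.2 + n%:~R) <= u <= Num.max p.2 (q.2 + n%:~R) ->
    ~ underpass (p.1, u).

(* An arc is the set of the positions on it.                                 *)
Definition is_arc (A : set pos) : Prop :=
  exists2 p : pos, ~ underpass p & A = [set q | same_arc p q].

Definition arc := {A : set pos | is_arc A}.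

Definition over_arc (c : crossing) (a : arc) : Prop := sval a c.1.

(* The underpassing arcs before and after the crossing.                      *)
Definition in_arc (c : crossing) (a : arc) : Prop :=
  \forall e \near 0^'+, sval a (c.2.1, c.2.2 - e).

Definition out_arc (c : crossing) (a : arc) : Prop :=
  \forall e \near 0^'+, sval a (c.2.1, c.2.2 + e).

Definition right_arc (c : crossing) (a : arc) : Prop :=
  if writhe c == 1 then in_arc c a else out_arc c a.

Definition left_arc (c : crossing) (a : arc) : Prop :=
  if writhe c == 1 then out_arc c a else in_arc c a.

Inductive link_relation : qterm arc -> qterm arc -> Prop :=
  | link_crossing (c : crossing) (a1 a2 a3 : arc) :
      c \in classical_crossings D ->
      over_arc c a1 -> right_arc c a2 -> left_arc c a3 ->
      link_relation (TGen a3) (TOp (TGen a2) (TGen a1)).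

Definition link_quandle : quandle := presented_quandle link_relation.

Definition link_quandle_tc : quandle := tc_quotient link_quandle.

End DiagramTheory.

End Diagrams.

(* Main.v *)
Require Import Defs.
From mathcomp Require Import all_boot all_order all_algebra.
From mathcomp Require Import all_classical all_reals all_analysis.
From mathcomp Require Import ring lra zify.
Import numFieldNormedType.Exports.

(** In a translation-commutative quandle the translation by [x] depends only on
    the orbit of [x], and the orbits of the quotient of a link quandle are the
    components of the link.  So each orbit is a quotient of the free abelian
    group on the components, in which the [k]-th basis vector acts as
    translation by the [k]-th component: following the [i]-th component through
    an underpass below the [k]-th one, of writhe [e], applies the [k]-th
    translation [e] times.  The stabilizer of an element of the [i]-th orbit is
    generated by the [i]-th basis vector, by idempotence, and by the vector of
    the linking numbers over the [i]-th component, by one full turn around it.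
    [link_coordinatized] proves that there are no other identifications: the
    coordinates of terms respect all relations, and conversely an element is
    recovered from its coordinates by letting them act on a chosen origin.

    An isomorphism permutes the components and carries stabilizers to
    stabilizers; up to the [i]-th coordinate these are cyclic, so it exists iff
    the rows of linking numbers agree up to one sign for each component
    ([coordinatized_iso]).  The signs of adjacent components of the linking
    graph agree because linking numbers of classical links are symmetric, and
    this gives one sign on each connected component of the graph.

    The symmetry ([linking_sym]) says that two closed plane curves [g], [h] cross
    algebraically zero times ([intersection_sum_zero]).  The map
    [F (t, u) = g t - h u] on the unit square takes the same values on opposite
    sides, so its winding number around the boundary vanishes; it is also the
    sum of the local indices at the zeros of [F], which are the signs of the
    crossings, up to a common sign.  The winding number is discretized: on a
    fine grid, the signed number of edges whose image crosses the positive
    horizontal axis is an algebraic expression in the values of [F] at the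
    vertices.  Edges with images in a common open half-plane contribute a
    telescoping sum ([ray_crossing_half_plane]), so grid cells away from the
    zeros contribute nothing, and a block of cells around a transverse zero
    contributes what its linearization does ([contour_sign]). *)

Set Implicit Arguments.
Unset Strict Implicit.
Unset Printing Implicit Defensive.

Import Order.TTheory GRing.Theory Num.Theory.
Local Open Scope classical_set_scope.
Local Open Scope ring_scope.

(** * Quandles with coordinates, and their isomorphisms *)

Definition ivec n := {ffun 'I_n -> int}.

Definition unitv n (j : 'I_n) : ivec n := [ffun k => (k == j)%:Z].

(** Induction in both directions along the basis vectors.  The equivalence as
    step hypothesis suits the properties proved with it, which are transported
    by bijections. *)
Lemma ivec_ind n (P : ivec n -> Prop) :
  P 0 -> (forall v j, P v <-> P (v + unitv j)) -> forall v, P v.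
Proof.
move=> P0 PS.
have PN v j : P v -> P (v - unitv j) by move=> Pv; apply/(PS _ j); rewrite subrK.
have Pz v j (k : int) : P v -> P (v + unitv j *~ k).
  move=> Pv; case: k => k; elim: k => [|k IH].
  - by rewrite addr0.
  - rewrite -pmulrn mulrSr addrA -PS //.
  - by apply: PN.
  - rewrite NegzE mulrNz -pmulrn mulrSr opprD addrA; apply: PN.
    by move: IH; rewrite NegzE mulrNz -pmulrn.
move=> v.
have -> : v = \sum_(j <- enum 'I_n) unitv j *~ v j.
  apply/ffunP => k; rewrite sum_ffunE big_enum /= (bigD1 k) //= big1 ?addr0.
    by rewrite ffunMzE ffunE eqxx intz.
  by move=> j jk; rewrite ffunMzE ffunE eq_sym (negPf jk) mul0rz.
elim: (enum _) => [|j s IH]; first by rewrite big_nil.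
by rewrite big_cons addrC; apply: Pz.
Qed.

Section Congruence.
Variables (n : nat) (L : 'I_n -> 'I_n -> int).

(** The subgroup generated by the [i]-th basis vector and the [i]-th row of [L],
    described by its elements: the [i]-th entry is arbitrary. *)
Definition stabv (i : 'I_n) (v : ivec n) : Prop :=
  exists k : int, forall j, j != i -> v j = k * L i j.

Lemma stabv0 i : stabv i 0.
Proof. by exists 0 => j _; rewrite ffunE mul0r. Qed.

Lemma stabvD i v w : stabv i v -> stabv i w -> stabv i (v + w).
Proof.
move=> [k kP] [l lP]; exists (k + l) => j ji.
by rewrite ffunE kP // lP // mulrDl.
Qed.

Lemma stabvN i v : stabv i v -> stabv i (- v).
Proof. by move=> [k kP]; exists (- k) => j ji; rewrite ffunE kP // mulNr. Qed.

Lemma stabv_unit i : stabv i (unitv i).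
Proof. by exists 0 => j /negPf ji; rewrite ffunE ji mul0r. Qed.

(** Equality of coordinates: the vectors matter only modulo the stabilizer. *)
Definition ceq (p q : 'I_n * ivec n) : Prop := p.1 = q.1 /\ stabv p.1 (p.2 - q.2).

Lemma ceq_refl p : ceq p p.
Proof. by split=> //; rewrite subrr; apply: stabv0. Qed.

Lemma ceq_sym p q : ceq p q -> ceq q p.
Proof. by move=> [e h]; split=> //; rewrite -e -opprB; apply: stabvN. Qed.

Lemma ceq_trans q p r : ceq p q -> ceq q r -> ceq p r.
Proof.
move=> [e h] [e' h']; split; first by rewrite e.
by rewrite -(subrK q.2 p.2) -addrA; apply: stabvD => //; rewrite e.
Qed.

Lemma ceqD p q v : ceq p q -> ceq (p.1, p.2 + v) (q.1, q.2 + v).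
Proof. by move=> [e h]; split=> //=; rewrite opprD addrACA subrr addr0. Qed.

Record coordinatized (Q : quandle) (co : Q -> 'I_n * ivec n) : Prop :=
  Coordinatized {
    co_op : forall x y,
      ceq (co (qop x y)) ((co x).1, (co x).2 + unitv (co y).1);
    co_inj : forall x y, ceq (co x) (co y) -> x = y;
    co_surj : forall p, exists x, ceq (co x) p }.

End Congruence.

Definition point n (L : 'I_n -> 'I_n -> int) Q co
    (H : @coordinatized n L Q co) p : Q := projT1 (cid (co_surj H p)).

Lemma pointP n L Q co (H : @coordinatized n L Q co) p : ceq L (co (point H p)) p.
Proof. exact: projT2 (cid (co_surj H p)). Qed.

Section Push.
Variables (n n' : nat).

(** The homomorphism that sends the [j]-th basis vector to the [s j]-th one. *)
Definition pushv (s : 'I_n -> 'I_n') (v : ivec n) : ivec n' :=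
  \sum_j unitv (s j) *~ v j.

Lemma pushv0 s : pushv s 0 = 0.
Proof. by apply: big1 => j _; rewrite ffunE mulr0z. Qed.

Lemma pushvD s v w : pushv s (v + w) = pushv s v + pushv s w.
Proof. by rewrite -big_split; apply: eq_bigr => j _; rewrite ffunE mulrzDr. Qed.

Lemma pushv_unit s j : pushv s (unitv j) = unitv (s j).
Proof.
rewrite /pushv (bigD1 j) //= ffunE eqxx big1 ?addr0 // => k kj.
by rewrite ffunE (negPf kj).
Qed.

Lemma pushv_inj s v j : injective s -> pushv s v (s j) = v j.
Proof.
move=> si; rewrite sum_ffunE (bigD1 j) //= ffunMzE ffunE eqxx big1 ?addr0 ?intz //.
by move=> k kj; rewrite ffunMzE ffunE (inj_eq si) eq_sym (negPf kj) mul0rz.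
Qed.

Lemma pushvN s v : pushv s (- v) = - pushv s v.
Proof. by apply/eqP; rewrite -addr_eq0 -pushvD addNr pushv0. Qed.

End Push.

Lemma pushvK n n' (s : 'I_n -> 'I_n') s' v : cancel s s' -> pushv s' (pushv s v) = v.
Proof.
move=> sK; elim/ivec_ind: v => [|v j]; first by rewrite !pushv0.
rewrite !pushvD !pushv_unit sK; split=> [-> //|]; exact: addIr.
Qed.

Section MapCoordinates.
Variables (n n' : nat) (L : 'I_n -> 'I_n -> int) (L' : 'I_n' -> 'I_n' -> int).
Variables (Q Q' : quandle) (co : Q -> 'I_n * ivec n) (co' : Q' -> 'I_n' * ivec n').
Hypotheses (H : coordinatized L co) (H' : coordinatized L' co').
Variable f : Q -> Q'.
Hypothesis fM : quandle_map f.

Definition orbit_map (i : 'I_n) : 'I_n' := (co' (f (point H (i, 0)))).1.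

Lemma point_op i v j w : point H (i, v + unitv j) = qop (point H (i, v)) (point H (j, w)).
Proof.
apply: (co_inj H); apply: ceq_trans (pointP _ _) _; apply: ceq_sym.
apply: ceq_trans (co_op H _ _) _.
by have [-> _] := pointP H (j, w); apply: (@ceqD _ _ (co (point H (i, v))) (i, v)) (pointP _ _).
Qed.

Lemma pointK x : point H (co x) = x.
Proof. by apply: (co_inj H); apply: pointP. Qed.

(** Translating by any element of the [j]-th orbit adds the [j]-th basis vector,
    and a quandle map preserves this; so it acts on coordinates by permuting the
    entries, up to the image of one point of each orbit. *)
Lemma map_point i v : ceq L' (co' (f (point H (i, v))))
  (orbit_map i, (co' (f (point H (i, 0)))).2 + pushv orbit_map v).
Proof.
elim/ivec_ind: v => [|v j].
  by rewrite pushv0 addr0 /orbit_map -surjective_pairing; apply: ceq_refl.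
rewrite (point_op i v j 0) fM pushvD pushv_unit addrA.
have := co_op H' (f (point H (i, v))) (f (point H (j, 0))).
rewrite -/(orbit_map j) => h; split=> [IH|IH].
  by apply: (ceq_trans h); apply: (ceqD _ IH).
move: (ceq_trans (ceq_sym h) IH) => /(@ceqD _ _ _ _ (- unitv (orbit_map j))) /=.
by rewrite !addrK -surjective_pairing.
Qed.

Lemma orbit_mapE x : (co' (f x)).1 = orbit_map (co x).1.
Proof.
rewrite -{1}(pointK x); case: (co x) => i v.
by have [] := map_point i v.
Qed.

End MapCoordinates.

Lemma orbit_mapK n n' L L' Q Q' co co'
    (H : @coordinatized n L Q co) (H' : @coordinatized n' L' Q' co') f g :
  quandle_map f -> quandle_map g -> cancel f g ->
  cancel (orbit_map co' H f) (orbit_map co H' g).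
Proof.
move=> fM gM fK i; have := orbit_mapE H' H gM (f (point H (i, 0))).
rewrite fK /orbit_map => <-; by have [] := pointP H (i, 0).
Qed.

(** The points of coordinates [0] and [L i] in the [i]-th orbit coincide, hence
    so do their images; this puts the permuted row in the stabilizer of the image. *)
Lemma map_stabilizer n n' L L' Q Q' co co'
    (H : @coordinatized n L Q co) (H' : @coordinatized n' L' Q' co') f :
  quandle_map f -> injective (orbit_map co' H f) ->
  forall i, exists k : int, forall j, j != i ->
    L i j = k * L' (orbit_map co' H f i) (orbit_map co' H f j).
Proof.
move=> fM si i; pose r : ivec n := [ffun j => L i j].
have rS : stabv L i r by exists 1 => j _; rewrite ffunE mul1r.
have E : point H (i, r) = point H (i, 0).
  apply: (co_inj H); apply: ceq_trans (pointP _ _) _; apply: ceq_sym.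
  by apply: ceq_trans (pointP _ _) _; split=> //=; rewrite sub0r; apply: stabvN.
have := map_point H H' fM i r; rewrite E => -[_] /= /stabvN.
rewrite opprB addrAC subrr add0r => -[k kP]; exists k => j ji.
by rewrite -kP ?(inj_eq si) // pushv_inj // ffunE.
Qed.

(** Used with two rows of linking numbers: integers [k], [l] with [k * l = 1]
    are signs, unless both rows vanish. *)
Lemma mutual_multiples (T : Type) (P : T -> Prop) (a b : T -> int) (k l : int) :
  (forall x, P x -> a x = k * b x) -> (forall x, P x -> b x = l * a x) ->
  exists2 e : int, e = -1 \/ e = 1 & forall x, P x -> a x = e * b x.
Proof.
move=> ak bl.
have [[x [Px ax]]|az] := pselect (exists x, P x /\ a x != 0).
  exists k => //; have := ak _ Px; rewrite bl // mulrA -{1}[a x]mul1r.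
  move/(mulIf ax)/esym/eqP; rewrite mulrC => /eqP kl.
  have /eqP : absz (l * k) = 1%N by rewrite kl.
  rewrite abszM muln_eq1 => /andP[_ /eqP k1].
  by case: (intP k) k1 => [|m|m] //=; [case: m => // _; right | case: m => // _; left].
exists 1; first by right.
have {}az x : P x -> a x = 0.
  by move=> Px; apply/eqP/negP => /negP ax; apply: az; exists x.
by move=> x Px; rewrite bl // az // !mulr0.
Qed.

(** A relabelling of the coordinates by [s] respects the stabilizers, so it can
    be lifted to the elements by choosing representatives. *)
Lemma iso_of_signs n n' L L' Q Q' co co'
    (H : @coordinatized n L Q co) (H' : @coordinatized n' L' Q' co')
    (s : 'I_n -> 'I_n') :
  bijective s ->
  (forall i, exists2 e : int, e = -1 \/ e = 1 &
    forall j, j != i -> L i j = e * L' (s i) (s j)) ->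
  quandle_iso Q Q'.
Proof.
move=> [s' sK s'K] sL; have si := can_inj sK.
have s'L i' : exists2 e : int, e = -1 \/ e = 1 &
    forall j', j' != i' -> L' i' j' = e * L (s' i') (s' j').
  have [e e1 eP] := sL (s' i'); exists e => // j' ji.
  rewrite eP ?(inj_eq (can_inj s'K)) // !s'K mulrA.
  by have -> : e * e = 1; [case: e1 => -> | rewrite mul1r].
pose F x := point H' (s (co x).1, pushv s (co x).2).
pose G x := point H (s' (co' x).1, pushv s' (co' x).2).
have pushS m m' (M : 'I_m -> 'I_m -> int) (M' : 'I_m' -> 'I_m' -> int)
   (t : 'I_m -> 'I_m') t' : cancel t t' -> cancel t' t ->
   (forall i, exists2 e : int, e = -1 \/ e = 1 &
      forall j, j != i -> M i j = e * M' (t i) (t j)) ->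
   forall p q, ceq M p q -> ceq M' (t p.1, pushv t p.2) (t q.1, pushv t q.2).
  move=> tK t'K tM p q [e [k kP]]; split=> /=; first by rewrite e.
  have [eps _ epsP] := tM p.1; exists (k * eps) => j jp.
  rewrite -pushvN -pushvD -(t'K j) pushv_inj ?kP ?epsP ?mulrA //.
  - by apply: contraNneq jp => <-; rewrite t'K.
  - by apply: contraNneq jp => <-; rewrite t'K.
  - exact: can_inj tK.
have FP x : ceq L' (co' (F x)) (s (co x).1, pushv s (co x).2) by apply: pointP.
have GP x : ceq L (co (G x)) (s' (co' x).1, pushv s' (co' x).2) by apply: pointP.
exists F; split.
  move=> x y; apply: (co_inj H').
  apply: ceq_trans (FP _) _; apply: ceq_trans (pushS _ _ _ _ _ _ sK s'K sL _ _ (co_op H x y)) _.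
  apply: ceq_sym; apply: ceq_trans (co_op H' _ _) _ => /=.
  have [-> _] := FP y; rewrite pushvD pushv_unit.
  exact: (ceqD (unitv (s (co y).1)) (FP x)).
exists G => x.
  apply: (co_inj H); apply: ceq_trans (GP _) _.
  apply: ceq_trans (pushS _ _ _ _ _ _ s'K sK s'L _ _ (FP x)) _ => /=.
  by rewrite sK pushvK // -surjective_pairing; apply: ceq_refl.
apply: (co_inj H'); apply: ceq_trans (FP _) _.
apply: ceq_trans (pushS _ _ _ _ _ _ sK s'K sL _ _ (GP x)) _ => /=.
by rewrite s'K pushvK // -surjective_pairing; apply: ceq_refl.
Qed.

Theorem coordinatized_iso n n' L L' Q Q' co co'
    (H : @coordinatized n L Q co) (H' : @coordinatized n' L' Q' co') :
  quandle_iso Q Q' <->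
  exists2 s : 'I_n -> 'I_n', bijective s &
    forall i, exists2 e : int, e = -1 \/ e = 1 &
      forall j, j != i -> L i j = e * L' (s i) (s j).
Proof.
split=> [[f [fM [g fK gK]]]|[s sB sL]]; last exact: iso_of_signs H H' s sB sL.
have gM : quandle_map g by move=> x y; rewrite -{1}(gK x) -{1}(gK y) -fM fK.
have sK := orbit_mapK H H' fM gM fK; have s'K := orbit_mapK H' H gM fM gK.
exists (orbit_map co' H f); first by exists (orbit_map co H' g).
move=> i; have [k kP] := map_stabilizer H' fM (can_inj sK) i.
have [l lP] := map_stabilizer H gM (can_inj s'K) (orbit_map co' H f i).
apply: (mutual_multiples (P := fun j => j != i) kP) => j ji.
by rewrite lP ?sK // (inj_eq (can_inj sK)).
Qed.

(** * Evaluation of terms and the action on translation-commutative quotients *)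

Section Evaluation.
Variables (n : nat) (L : 'I_n -> 'I_n -> int).
Variables (X : Type) (E : qterm X -> qterm X -> Prop) (f : X -> 'I_n * ivec n).

(** The coordinates of a term computed from those of the generators, so that no
    quotient has to be built as a model. *)
Fixpoint eval_term (t : qterm X) : 'I_n * ivec n :=
  match t with
  | TGen x => f x
  | TOp a b => ((eval_term a).1, (eval_term a).2 + unitv (eval_term b).1)
  | TInv a b => ((eval_term a).1, (eval_term a).2 - unitv (eval_term b).1)
  end.

Hypothesis fE : forall a b, E a b -> ceq L (eval_term a) (eval_term b).

Lemma eval_term_qeq a b : qeq E a b -> ceq L (eval_term a) (eval_term b).
Proof.
elim=> {a b} /=.
- exact: fE.
- by move=> a; apply: ceq_refl.
- by move=> a b _; apply: ceq_sym.
- by move=> a b c _ ab _; apply: ceq_trans.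
- by move=> a a' b b' _ aa' _ [-> _]; apply: ceqD.
- by move=> a a' b b' _ aa' _ [-> _]; apply: ceqD.
- by move=> a; split=> //=; rewrite addrC addKr; apply: stabv_unit.
- by move=> a b; rewrite addrK -surjective_pairing; apply: ceq_refl.
- by move=> a b; rewrite subrK -surjective_pairing; apply: ceq_refl.
- by move=> a b c; rewrite addrAC; apply: ceq_refl.
Qed.

Definition pres_coord (A : presented_quandle E) : 'I_n * ivec n :=
  eval_term (repr (A : presented_carrier E)).

Lemma pres_coord_class t : ceq L (pres_coord (presented_class E t)) (eval_term t).
Proof. exact/eval_term_qeq/repr_presented. Qed.

Lemma pres_coord_op (A B : presented_quandle E) :
  ceq L (pres_coord (qop A B)) ((pres_coord A).1, (pres_coord A).2 + unitv (pres_coord B).1).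
Proof. exact: (pres_coord_class (TOp (repr A) (repr B))). Qed.

End Evaluation.

Section TcCoordinates.
Variables (n : nat) (L : 'I_n -> 'I_n -> int) (Q : quandle) (co : Q -> 'I_n * ivec n).
Hypothesis coM : forall x y, ceq L (co (qop x y)) ((co x).1, (co x).2 + unitv (co y).1).

Lemma tc_coord_rel a b :
  tc_relation a b -> ceq L (eval_term co a) (eval_term co b).
Proof.
case=> [p q|p q r] /=; first exact: coM.
by rewrite addrAC; apply: ceq_refl.
Qed.

End TcCoordinates.

Lemma qop_injl (Q : quandle) (y x x' : Q) : qop x y = qop x' y -> x = x'.
Proof. exact: (bij_inj (qop_bij y)). Qed.

Lemma presented_qopE X (E : qterm X -> qterm X -> Prop) a b :
  @qop (presented_quandle E) (presented_class E a) (presented_class E b) =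
  presented_class E (TOp a b).
Proof. exact: presented_opE. Qed.

Section TcQuotient.
Variable Q : quandle.
Local Notation T := (tc_quotient Q).

Definition tc_class (q : Q) : T := presented_class (@tc_relation Q) (TGen q).

Definition tc_inv (x y : T) : T := presented_inv x y.

Lemma tc_invK x y : tc_inv (qop x y) y = x.
Proof.
rewrite -[x]presented_reprK -[y]presented_reprK /tc_inv presented_qopE presented_invE.
by apply/presented_classP; apply: qeq_invK.
Qed.

Lemma tc_opK x y : qop (tc_inv x y) y = x.
Proof.
rewrite -[x]presented_reprK -[y]presented_reprK /tc_inv presented_invE.
rewrite presented_qopE.
by apply/presented_classP; apply: qeq_opK.
Qed.

Lemma tc_classM p q : tc_class (qop p q) = qop (tc_class p) (tc_class q).
Proof. by rewrite presented_qopE; apply/presented_classP; apply/qeq_rel/tc_mul. Qed.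

(** The generators of the quotient are closed under the operation, by the first
    relations, and under inverse translations, which are operations with an
    element obtained by inverting in the given quandle. *)
Lemma tc_class_surj x : exists q, x = tc_class q.
Proof.
rewrite -[x]presented_reprK; elim: (repr _) => [q|a [p ap] b [q bq]|a [p ap] b [q bq]].
- by exists q.
- by exists (qop p q); rewrite tc_classM -ap -bq -presented_qopE.
- have [g _ gK] := qop_bij q; exists (g p).
  by rewrite -presented_invE ap bq -{1}(gK p) tc_classM; apply: tc_invK.
Qed.

(** The defining relations give this for generators only, but every element is one. *)
Lemma tc_opAC (x y z : T) : qop (qop x y) z = qop (qop x z) y.
Proof.
have [p ->] := tc_class_surj x; have [q ->] := tc_class_surj y.
have [r ->] := tc_class_surj z; pose E := presented_qopE (@tc_relation Q).
rewrite /tc_class (E (TGen p) (TGen q)) (E (TGen p) (TGen r)) (E _ (TGen q)) (E _ (TGen r)).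
by apply/presented_classP; apply/qeq_rel/tc_comm.
Qed.

End TcQuotient.

Section Action.
Variables (T : quandle) (inv : T -> T -> T).
Hypotheses (invK : forall x y, inv (qop x y) y = x)
  (opK : forall x y, qop (inv x y) y = x)
  (opAC : forall x y z : T, qop (qop x y) z = qop (qop x z) y).

(** So all elements of an orbit translate in the same way. *)
Lemma op_op (z x y : T) : qop z (qop x y) = qop z x.
Proof. by rewrite -{1}(opK z y) -qop_dist opAC opK. Qed.

Lemma inv_op (z x y : T) : qop (inv x y) z = inv (qop x z) y.
Proof. by rewrite -{2}(opK x y) opAC invK. Qed.

Variables (n : nat) (b : 'I_n -> T).

Definition stepz (j : 'I_n) (k : int) (x : T) : T :=
  match k with
  | Posz m => iter m (fun y => qop y (b j)) x
  | Negz m => iter m.+1 (fun y => inv y (b j)) x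
  end.

Lemma stepzS j k x : stepz j (k + 1) x = qop (stepz j k x) (b j).
Proof.
case: k => [m|[|m]]; first by rewrite -PoszD addn1.
  exact/esym/opK.
have -> : Negz m.+1 + 1 = Negz m by rewrite !NegzE -[m.+2]addn1 PoszD opprD subrK.
exact/esym/opK.
Qed.

Lemma stepz_op j k x z : qop (stepz j k x) z = stepz j k (qop x z).
Proof.
case: k => m /=; last rewrite inv_op; last congr (inv _ _).
  by elim: m => //= m IH; rewrite opAC IH.
by elim: m => //= m IH; rewrite inv_op IH.
Qed.

(** The order in which the basis vectors act is immaterial, because the
    translations commute. *)
Definition act (v : ivec n) (x : T) : T :=
  foldr (fun j y => stepz j (v j) y) x (enum 'I_n).

Lemma act0 x : act 0 x = x.
Proof. by rewrite /act; elim: (enum _) => //= j s ->; rewrite ffunE. Qed.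

Lemma act_unit v j x : act (v + unitv j) x = qop (act v x) (b j).
Proof.
suff E s : uniq s -> foldr (fun j' y => stepz j' ((v + unitv j) j') y) x s =
    let y := foldr (fun j' y => stepz j' (v j') y) x s in
    if j \in s then qop y (b j) else y.
  by rewrite /act E ?enum_uniq // mem_enum.
elim: s => //= k s IH /andP[ks us]; rewrite inE IH //= !ffunE.
have [->|jk] := eqVneq j k; first by rewrite (negPf ks) /= stepzS.
rewrite addr0 /=; case: ifP => // _.
by rewrite stepz_op.
Qed.

Lemma actD v w x : act (v + w) x = act v (act w x).
Proof.
elim/ivec_ind: v => [|v j]; first by rewrite add0r act0.
rewrite addrAC !act_unit; split=> [-> //|].
exact: qop_injl.
Qed.

Lemma op_act z v x : qop z (act v x) = qop z x.
Proof.
elim/ivec_ind: v => [|v j]; first by rewrite act0.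
by rewrite act_unit op_op.
Qed.

Lemma act_fixM v x (k : int) : act v x = x -> act (v *~ k) x = x.
Proof.
move=> vx; have pos (m : nat) : act (v *+ m) x = x.
  by elim: m => [|m IH]; rewrite ?mulr0n ?act0 // mulrS actD IH.
case: k => m; first exact: pos.
by rewrite NegzE mulrNz -pmulrn -[in LHS](pos m.+1) -actD addNr act0.
Qed.

End Action.

(** * Discreteness of the underpasses *)

(** The form in which the general position of the crossings is used. *)
Lemma uniq_flatten_pairs (T : eqType) (s : seq (T * T)) :
  uniq (flatten [seq [:: c.1; c.2] | c <- s]) ->
  [/\ uniq s, {in s &, forall c d, c.1 != d.2},
      {in s &, injective fst} & {in s &, injective snd}].
Proof.
elim: s => [|c s IH] /=; first by split.
have fl (S : seq (T * T)) d : d \in S ->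
    (d.1 \in flatten [seq [:: c.1; c.2] | c <- S]) *
    (d.2 \in flatten [seq [:: c.1; c.2] | c <- S]).
  move=> dS; split; apply/flattenP; exists [:: d.1; d.2];
    rewrite ?inE ?eqxx ?orbT //; exact: map_f.
rewrite inE negb_or => /andP[/andP[c12 c1s] /andP[c2s /IH[us d12 i1 i2]]].
have n1 d : d \in s -> (c.1 != d.1) * (c.1 != d.2).
  by move=> /fl[d1 d2]; split; apply: contraNneq c1s => ->.
have n2 d : d \in s -> (c.2 != d.1) * (c.2 != d.2).
  by move=> /fl[d1 d2]; split; apply: contraNneq c2s => ->.
split.
- by rewrite us andbT; apply/negP => /n1; rewrite eqxx => -[].
- move=> d e; rewrite !inE => /predU1P[->|ds] /predU1P[->|es] //.
  + by rewrite n1.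
  + by rewrite eq_sym n2.
  + exact: d12.
- move=> d e; rewrite !inE => /predU1P[->|ds] /predU1P[->|es] // h.
  + by have := n1 _ es; rewrite h eqxx => -[].
  + by have := n1 _ ds; rewrite h eqxx => -[].
  + exact: i1.
- move=> d e; rewrite !inE => /predU1P[->|ds] /predU1P[->|es] // h.
  + by have := n2 _ es; rewrite h eqxx => -[].
  + by have := n2 _ ds; rewrite h eqxx => -[].
  + exact: i2.
Qed.

Section Floor.
Variable R : realType.

Lemma floor_no_translate (s x y : R) : x <= y ->
  (forall m : int, x < s + m%:~R <= y -> False) -> Num.floor (x - s) = Num.floor (y - s).
Proof.
move=> xy no; apply/eqP; rewrite eq_le le_floor ?lerB //= floor_ge_int.
rewrite leNgt; apply/negP => h; apply: (no (Num.floor (y - s))).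
by have := floor_le (y - s); lra.
Qed.

(** The positions of an underpass on the parameter line are the integer
    translates of one parameter; with finitely many crossings this isolates all
    underpasses. *)
Lemma int_translate_isolated (s y : R) :
  exists2 e : R, 0 < e & forall m : int, `|s + m%:~R - y| < e -> s + m%:~R = y.
Proof.
pose d := y - s - (Num.floor (y - s))%:~R.
have d0 : 0 <= d by rewrite subr_ge0 floor_le.
have d1 : d < 1 by rewrite ltrBlDl -intrD1 floorD1_gt.
have [dz|dn] := eqVneq d 0.
  exists 1 => // m; rewrite ltr_norml => /andP[h1 h2].
  have ys : y - s = (Num.floor (y - s))%:~R by apply/eqP; rewrite -subr_eq0 -/d dz.
  have : `|(m - Num.floor (y - s))%:~R : R| < 1.
    by rewrite intrB -ys ltr_norml; apply/andP; split; lra.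
  rewrite -intr_norm (ltr_int _ _ 1) => h.
  have -> : m = Num.floor (y - s) by apply/eqP; rewrite -subr_eq0 -normr_le0 -ltzD1.
  by rewrite -ys addrC subrK.
have dp : 0 < d by rewrite lt_neqAle eq_sym dn.
exists (Num.min d (1 - d)); first by rewrite lt_min dp subr_gt0.
move=> m; rewrite lt_min !ltr_norml => /andP[/andP[h1 _] /andP[_ h4]].
have : (Num.floor (y - s))%:~R < m%:~R :> R by rewrite /d in h1 *; lra.
have : m%:~R < (Num.floor (y - s) + 1)%:~R :> R by rewrite intrD1 /d in h4 *; lra.
by rewrite !ltr_int ltzD1 leNgt => /negP.
Qed.

End Floor.

(** * Arcs of a diagram *)

Section Arcs.
Variables (R : realType) (D : diagram R).
Local Notation n := (ncomp D).
Local Notation pos := (position R n).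
Local Notation cc := (classical_crossings D).

Lemma crossings_distinct : [/\ uniq cc, {in cc &, forall c d, c.1 != d.2},
  {in cc &, injective fst} & {in cc &, injective snd}].
Proof.
apply: uniq_flatten_pairs; have := crossings_uniq D.
by rewrite map_cat flatten_cat cat_uniq => /and3P[].
Qed.

Lemma crossing_range c : c \in cc -> (0 <= c.1.2 < 1) /\ (0 <= c.2.2 < 1).
Proof.
case: c => p q cD;
have [_ h] := crossings_complete p q.
by have [] : _ := h _; first by left; rewrite mem_cat cD.
Qed.

Lemma underpassP (i : 'I_n) (t : R) : @underpass _ D (i, t) <->
  exists c, [/\ c \in cc, c.2.1 = i & exists m : int, t = c.2.2 + m%:~R].
Proof.
split=> -[c [cD ci]] /=.
  by move=> /intrP[m mE]; exists c; split=> //; exists m; rewrite -mE addrC subrK.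
by move=> [m ->]; exists c; split=> //=; rewrite addrAC subrr add0r intr_int.
Qed.

Lemma underpass_shift i t (m : int) :
  @underpass _ D (i, t + m%:~R) <-> @underpass _ D (i, t).
Proof.
split=> /underpassP[c [cD ci [k kE]]]; apply/underpassP; exists c; split=> //.
  by exists (k - m); rewrite intrB addrA -kE addrK.
by exists (k + m); rewrite intrD addrA -kE.
Qed.

(** So the overpassing position of a crossing lies on an arc. *)
Lemma overpass_not_underpass c : c \in cc -> ~ @underpass _ D c.1.
Proof.
move=> cD; rewrite [c.1]surjective_pairing => /underpassP[d [dD di [m mE]]].
have [_ /(_ _ _ cD dD)/negP + _ _] := crossings_distinct; apply.
have [/andP[c0 c1] _] := crossing_range cD; have [_ /andP[d0 d1]] := crossing_range dD.
have m0 : m = 0.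
  have : -1 < m%:~R :> R by lra.
  have : m%:~R < 1 :> R by lra.
  rewrite (ltr_int _ _ 1) -(intrN _ 1) ltr_int; lia.
by rewrite [c.1]surjective_pairing [d.2]surjective_pairing di mE m0 addr0.
Qed.

Lemma same_underpass c d (m k : int) : c \in cc -> d \in cc -> c.2.1 = d.2.1 ->
  c.2.2 + m%:~R = d.2.2 + k%:~R -> c = d /\ m = k.
Proof.
move=> cD dD i12 e.
have [_ /andP[c0 c1]] := crossing_range cD; have [_ /andP[d0 d1]] := crossing_range dD.
have mk : m = k.
  have : -1 < (m - k)%:~R :> R by rewrite intrB; lra.
  have : (m - k)%:~R < 1 :> R by rewrite intrB; lra.
  rewrite (ltr_int _ _ 1) -(intrN _ 1) ltr_int; lia.
have [_ _ _ inj] := crossings_distinct; split=> //; apply: inj => //.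
rewrite [c.2]surjective_pairing [d.2]surjective_pairing i12.
by rewrite mk in e; rewrite (addIr _ e).
Qed.

Lemma underpass_isolated (i : 'I_n) (y : R) : exists2 e, 0 < e &
  forall x, `|x - y| < e -> @underpass _ D (i, x) -> x = y.
Proof.
suff [e e0 eP] : exists2 e, 0 < e & forall c, c \in cc -> forall m : int,
    `|c.2.2 + m%:~R - y| < e -> c.2.2 + m%:~R = y.
  by exists e => // x xe /underpassP[c [cD _ [m mE]]]; rewrite mE in xe *; apply: eP.
elim: (cc) => [|c s [e e0 eP]]; first by exists 1.
have [d d0 dP] := int_translate_isolated c.2.2 y.
exists (Num.min e d); first by rewrite lt_min e0.
move=> b; rewrite inE => /predU1P[->|bs] m; rewrite lt_min => /andP[he hd].
  exact: dP.
exact: eP.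
Qed.

(** [x] and [y] are parameters of the same arc of the [i]-th component, reached
    from each other without going around the component. *)
Definition free (i : 'I_n) (x y : R) : Prop :=
  forall u, Num.min x y <= u <= Num.max x y -> ~ @underpass _ D (i, u).

Lemma freeP i x y : x <= y ->
  free i x y <-> forall u, x <= u <= y -> ~ @underpass _ D (i, u).
Proof. by move=> xy; rewrite /free (min_idPl xy) (max_idPr xy). Qed.

Lemma free_sym i x y : free i x y -> free i y x.
Proof. by rewrite /free minC maxC. Qed.

Lemma free_trans i x y z : free i x y -> free i y z -> free i x z.
Proof.
move=> xy yz u; rewrite ge_min le_max => /andP[h1 h2].
have [uy|yu] := leP u y.
  by case/orP: h1 => h1; [apply: xy|apply: yz]; rewrite ge_min le_max h1 uy !orbT.
by case/orP: h2 => h2; [apply: xy|apply: yz]; rewrite ge_min le_max h2 (ltW yu) !orbT.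
Qed.

Lemma free_shift (m : int) i x y : free i x y -> free i (x + m%:~R) (y + m%:~R).
Proof.
move=> xy u; rewrite ge_min le_max => h.
rewrite -(subrK m%:~R u) underpass_shift; apply: xy.
by rewrite ge_min le_max !lerBrDr !lerBlDr.
Qed.

Arguments free_shift m [i x y] _.

Lemma free_refl i x : ~ @underpass _ D (i, x) -> free i x x.
Proof. by move=> nu u; rewrite minxx maxxx -eq_le => /eqP <-. Qed.

Lemma free_left i x y : free i x y -> ~ @underpass _ D (i, x).
Proof. by apply; rewrite ge_min le_max lexx. Qed.

Lemma arc_mem (a : Defs.arc D) p : sval a p -> forall q, sval a q <->
  p.1 = q.1 /\ exists m : int, free p.1 p.2 (q.2 + m%:~R).
Proof.
case: a => A [p0 np0 AE] /=; rewrite AE /= => -[e [m mP]] q.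
split=> -[e' [k kP]]; split.
- by rewrite -e -e'.
- exists (k - m); have := free_shift (- m) (free_trans (free_sym mP) kP).
  by rewrite intrB intrN addrK addrA -e.
- by rewrite e e'.
- exists (k + m); rewrite intrD addrA; apply: free_trans mP _.
  by rewrite e; apply: free_shift.
Qed.

Lemma arc_not_underpass (a : Defs.arc D) p : sval a p -> ~ underpass p.
Proof.
move=> ap; have [/(_ ap) [_ [m mP]] _] := arc_mem ap p.
by have := free_left mP; rewrite -surjective_pairing.
Qed.

Lemma arc_exists p : ~ @underpass _ D p -> exists a : Defs.arc D, sval a p.
Proof.
move=> np; exists (exist _ _ (ex_intro2 _ _ p np erefl)); split=> //.
by exists 0; rewrite addr0; apply: free_refl; rewrite -surjective_pairing.
Qed.

Lemma arc_unique (a b : Defs.arc D) p : sval a p -> sval b p -> a = b.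
Proof.
move=> ap bp; have ab : sval a = sval b.
  by apply/predeqP => q; rewrite (arc_mem ap) (arc_mem bp).
by case: a b ab {ap bp} => [A ?] [B ?] /= ab; apply: eq_exist.
Qed.

Lemma arc_free (a : Defs.arc D) i x y : sval a (i, x) -> free i x y -> sval a (i, y).
Proof. by move=> ax xy; apply/(arc_mem ax); split=> //; exists 0; rewrite addr0. Qed.

Lemma arc_shift (a : Defs.arc D) i x (m : int) :
  sval a (i, x) -> sval a (i, x + m%:~R).
Proof.
move=> ax; apply/(arc_mem ax); split=> //; exists (- m).
by rewrite intrN /= addrK; apply: free_refl; apply: arc_not_underpass ax.
Qed.

(** The coordinates of the arc at [t].  The floor counts, with sign, the passages
    through the underpass of [c] between the parameter of that underpass and [t],
    so that nothing has to be fixed about a starting point or the range of [t]. *)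
Definition height (i : 'I_n) (t : R) : ivec n :=
  \sum_(c <- cc | c.2.1 == i) unitv c.1.1 *~ (writhe c * Num.floor (t - c.2.2)).

(** What a full turn around the component adds to the height. *)
Definition turn (i : 'I_n) : ivec n := [ffun j => linking i j].

Lemma height_shift i t (m : int) : height i (t + m%:~R) = height i t + turn i *~ m.
Proof.
have -> : turn i = \sum_(c <- cc | c.2.1 == i) unitv c.1.1 *~ writhe c.
  apply/ffunP => j; rewrite sum_ffunE !ffunE /linking /linking_over.
  rewrite big_mkcond [RHS]big_mkcond /=; apply: eq_bigr => c _.
  rewrite ffunMzE ffunE [j == _]eq_sym.
  by case: (c.2.1 == i); case: (_ == j); rewrite /= ?intz ?mul0rz.
rewrite mulrz_suml -big_split; apply: eq_bigr => c _ /=.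
by rewrite -mulrzA -mulrzDr addrAC floorDrz ?intr_int // intrKfloor mulrDr.
Qed.

Lemma crossing_underpass i c (m : int) : c \in cc -> c.2.1 = i ->
  @underpass _ D (i, c.2.2 + m%:~R).
Proof. by move=> cD ci; apply/underpassP; exists c; split=> //; exists m. Qed.

Lemma height_free i x y : free i x y -> height i x = height i y.
Proof.
wlog xy : x y / x <= y => [th|] F.
  have [/th|/ltW/th] := leP x y; first exact.
  by move=> /(_ (free_sym F)).
rewrite /height big_seq_cond [RHS]big_seq_cond.
apply: eq_bigr => c /andP[cD /eqP ci]; rewrite (floor_no_translate xy) // => m /andP[m1 m2].
by apply: (((freeP _ xy).1 F) _ _ (crossing_underpass m cD ci)); rewrite (ltW m1).
Qed.

Definition single_underpass i c x x' : Prop :=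
  [/\ c \in cc, c.2.1 = i & exists y, [/\ x < y < x',
     exists m : int, y = c.2.2 + m%:~R &
     forall u, x <= u <= x' -> @underpass _ D (i, u) -> u = y]].

(** The floor for [c] increases by one; the others are constant because distinct
    crossings do not share a position. *)
Lemma height_single_underpass i c x x' : single_underpass i c x x' ->
  height i x' = height i x + unitv c.1.1 *~ writhe c.
Proof.
move=> [cD ci [y [/andP[xy yx'] [m mE] no]]]; have [uc _ _ _] := crossings_distinct.
rewrite /height big_mkcond [in RHS]big_mkcond /=.
rewrite [LHS](bigD1_seq c) // [in RHS](bigD1_seq c) //= ci eqxx addrAC.
congr (_ + _).
  rewrite -mulrzDr; congr (_ *~ _).
  have -> : Num.floor (x' - c.2.2) = m.
    apply: floor_def; rewrite intrD1; apply/andP; split; first lra.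
    rewrite ltNge; apply/negP => h.
    have := no _ _ (crossing_underpass (m + 1) cD ci); rewrite intrD1 mE; lra.
  have -> : Num.floor (x - c.2.2) = m - 1.
    apply: floor_def; rewrite subrK intrB; apply/andP; split; last lra.
    rewrite leNgt; apply/negP => h.
    have := no _ _ (crossing_underpass (m - 1) cD ci); rewrite intrB mE; lra.
  by rewrite mulrBr mulr1 subrK.
rewrite big_seq_cond [RHS]big_seq_cond; apply: eq_bigr => d /andP[dD dc].
case: eqP => // di; rewrite (@floor_no_translate _ _ x x') //; first lra.
move=> k /andP[k1 k2]; have e : d.2.2 + k%:~R = y.
  by apply: (no _ _ (crossing_underpass k dD di)); rewrite (ltW k1).
move/eqP: dc; apply; rewrite mE in e.
by have [->] := same_underpass dD cD (etrans di (esym ci)) e.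
Qed.

(** The incoming underpassing arc is on the right of the overpassing one iff the
    writhe is [1]. *)
Lemma link_relation_single_underpass i c x x' (a a' a1 : Defs.arc D) : single_underpass i c x x' ->
  sval a (i, x) -> sval a' (i, x') -> sval a1 c.1 ->
  if writhe c == 1 then link_relation (TGen a') (TOp (TGen a) (TGen a1))
  else link_relation (TGen a) (TOp (TGen a') (TGen a1)).
Proof.
move=> [cD ci [y [/andP[xy yx'] [m mE] no]]] ax ax' a1c.
have ia : in_arc c a.
  near=> e; rewrite -[c.2.2 - e](addrK m%:~R) -intrN ci; apply/arc_shift/(arc_free ax).
  have e0 : 0 < e by near: e; apply: nbhs_right_gt.
  have ey : e < y - x by near: e; apply: nbhs_right_lt; rewrite subr_gt0.
  apply/freeP; first by lra.
  by move=> u /andP[u1 u2] /no; lra.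
have oa : out_arc c a'.
  near=> e; rewrite -[c.2.2 + e](addrK m%:~R) -intrN ci; apply/arc_shift/(arc_free ax').
  have e0 : 0 < e by near: e; apply: nbhs_right_gt.
  have ey : e < x' - y by near: e; apply: nbhs_right_lt; rewrite subr_gt0.
  apply/free_sym/freeP; first by lra.
  by move=> u /andP[u1 u2] /no; lra.
by case: ifP => w; apply: (link_crossing cD a1c); rewrite /Defs.right_arc /Defs.left_arc w.
Unshelve. all: by end_near. Qed.

(** All relations arise from the two sides of a single underpass, since
    underpasses are isolated. *)
Lemma link_relation_inv s t : @link_relation _ D s t ->
  exists i c x x' a a' a1, [/\ single_underpass i c x x', sval a (i, x),
    sval a' (i, x'), sval a1 c.1 &
   (s, t) = if writhe c == 1 then (TGen a', TOp (TGen a) (TGen a1))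
            else (TGen a, TOp (TGen a') (TGen a1))].
Proof.
case=> c a1 a2 a3 cD a1c a2c a3c.
pose a := if writhe c == 1 then a2 else a3.
pose a' := if writhe c == 1 then a3 else a2.
have ia : in_arc c a by move: a2c a3c; rewrite /Defs.right_arc /Defs.left_arc /a; case: ifP.
have oa : out_arc c a' by move: a2c a3c; rewrite /Defs.right_arc /Defs.left_arc /a'; case: ifP.
have [e e0 eP] := underpass_isolated c.2.1 c.2.2.
have [d [d0 de da da']] : exists d, [/\ 0 < d, d < e, sval a (c.2.1, c.2.2 - d) &
    sval a' (c.2.1, c.2.2 + d)].
  near (0 : R)^'+ => d; exists d; split; near: d => //.
  - exact: nbhs_right_gt.
  - exact: nbhs_right_lt.
exists c.2.1, c, (c.2.2 - d), (c.2.2 + d), a, a', a1; split=> //.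
  split=> //; exists c.2.2; split; first by apply/andP; split; lra.
    by exists 0; rewrite addr0.
  by move=> u /andP[u1 u2]; apply: eP; rewrite ltr_norml; apply/andP; split; lra.
by rewrite /a /a'; case: (writhe c == 1).
Unshelve. all: by end_near. Qed.

Lemma writhe_cases (c : pos * pos) : writhe c = 1 \/ writhe c = -1.
Proof. by rewrite /writhe; case: ifP; [left|right]. Qed.

Lemma free_or_single_underpass i y e x x' :
  (forall u, `|u - y| < e -> @underpass _ D (i, u) -> u = y) ->
  `|x - y| < e -> `|x' - y| < e -> x <= x' ->
  ~ @underpass _ D (i, x) -> ~ @underpass _ D (i, x') ->
  free i x x' \/ exists c, single_underpass i c x x'.
Proof.
move=> iso; rewrite !ltr_norml => /andP[x1 x2] /andP[x1' x2'] xx' nx nx'.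
have only u : x <= u <= x' -> @underpass _ D (i, u) -> u = y.
  by move=> /andP[u1 u2]; apply: iso; rewrite ltr_norml; apply/andP; split; lra.
have [[xyx' uy]|no] := pselect (x <= y <= x' /\ @underpass _ D (i, y)); [right|left].
  have /underpassP[c [cD ci cm]] := uy; exists c; split=> //; exists y; split=> //.
  have /andP[xy yx'] := xyx'; rewrite !lt_neqAle xy yx' !andbT.
  by apply/andP; split; apply/negP => /eqP E; [apply: nx; rewrite E | apply: nx'; rewrite -E].
apply/freeP => // u uI uu; apply: no.
by have <- := only u uI uu.
Qed.

Lemma not_underpass_near i y e : 0 < e ->
  exists2 x : R, `|x - y| < e & ~ @underpass _ D (i, x).
Proof.
move=> e0; have [d d0 dP] := underpass_isolated i y.
have m0 : 0 < Num.min e d by rewrite lt_min e0.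
have [h1 h2] : Num.min e d <= e /\ Num.min e d <= d by rewrite !ge_min !lexx orbT.
have E : `|y + Num.min e d / 2 - y| = Num.min e d / 2.
  by rewrite addrAC subrr add0r ger0_norm //; lra.
exists (y + Num.min e d / 2); rewrite ?E; first lra.
by move=> /dP; rewrite E; lra.
Qed.

(** The derivative vanishes. *)
Lemma locally_constant (f : R -> R) :
  (forall y, exists2 e, 0 < e & forall x, `|x - y| < e -> f x = f y) ->
  forall x y, f x = f y.
Proof.
move=> lc x z; apply: is_derive_0_is_cst => y.
have [e e0 eP] := lc y.
have d0 : is_derive y (1 : R) (fun=> f y) 0 by exact: is_derive_cst.
apply: near_eq_is_derive d0.
apply/nbhs_ballP; exists e => //= u; rewrite /ball /= distrC => ue.
by rewrite (eP _ ue).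
Qed.

(** Underpasses are isolated, so each parameter has a neighborhood with at most
    one of them, in which [P] holds at all other parameters or at none.  Whether
    [P] holds nearby is therefore locally constant on the line. *)
Lemma component_walk i (P : R -> Prop) :
  (forall x x', free i x x' -> P x -> P x') ->
  (forall c x x', single_underpass i c x x' -> ~ @underpass _ D (i, x) ->
     ~ @underpass _ D (i, x') -> P x <-> P x') ->
  forall x0 x, ~ @underpass _ D (i, x0) -> ~ @underpass _ D (i, x) -> P x0 -> P x.
Proof.
move=> Pf Pp x0 x n0 nx P0.
have step y : exists2 e, 0 < e & forall z z', `|z - y| < e -> `|z' - y| < e ->
    ~ @underpass _ D (i, z) -> ~ @underpass _ D (i, z') -> P z -> P z'.
  have [e e0 eP] := underpass_isolated i y; exists e => // z z' ze ze' nz nz'.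
  have [zz'|/ltW z'z] := leP z z'.
    have [F|[c cP]] := free_or_single_underpass eP ze ze' zz' nz nz'; first exact: Pf.
    by case: (Pp _ _ _ cP nz nz').
  have [F|[c cP]] := free_or_single_underpass eP ze' ze z'z nz' nz; first exact/Pf/free_sym.
  by case: (Pp _ _ _ cP nz' nz).
pose A y := exists2 e, 0 < e & forall z, `|z - y| < e -> ~ @underpass _ D (i, z) -> P z.
have PA z : ~ @underpass _ D (i, z) -> P z <-> A z.
  move=> nz; split=> [Pz|[e e0]].
    have [e e0 eP] := step z; exists e => // z' z'e nz'.
    by apply: (eP z z'); rewrite ?subrr ?normr0.
  by apply; rewrite ?subrr ?normr0.
rewrite PA //; rewrite PA // in P0.
suff : (if `[< A x >] then 1 else 0) = (if `[< A x0 >] then 1 else 0) :> R.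
  rewrite (asboolT P0); case: asboolP => // _ /eqP.
  by rewrite eq_sym oner_eq0.
apply: (@locally_constant (fun y => if `[< A y >] then 1 else 0)) => y {x x0 n0 nx P0}.
have [e e0 eP] := step y; exists e => // x xe.
suff -> : A x = A y by [].
apply/propext; split=> -[d d0 dP].
  have d'0 : 0 < Num.min d (e - `|x - y|) by rewrite lt_min d0 subr_gt0.
  have [z] := not_underpass_near i x d'0; rewrite lt_min => /andP[zd ze] nz.
  have zy : `|z - y| < e by have := ler_distD x z y; lra.
  by exists e => // z' z'e nz'; apply: (eP z z') => //; apply: dP.
have d'0 : 0 < Num.min d e by rewrite lt_min d0.
have [z] := not_underpass_near i y d'0; rewrite lt_min => /andP[zd ze] nz.
exists (e - `|x - y|); first by rewrite subr_gt0.
move=> z' z'x nz'; apply: (eP z z') => //; last exact: dP.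
by have := ler_distD x z' y; lra.
Qed.

(** * Coordinates on the quotient of a link quandle *)

Lemma arc_pos (a : Defs.arc D) : exists p : pos, sval a p.
Proof.
by case: a => A [p np AE]; exists p; rewrite /= AE; split=> //; exists 0; rewrite addr0;
  apply: free_refl; rewrite -surjective_pairing.
Qed.

Local Notation L := (@linking R D).
Local Notation Q := (link_quandle D).
Local Notation T := (link_quandle_tc D).

Lemma stabv_turn i (m : int) : stabv L i (turn i *~ m).
Proof. by exists m => j _; rewrite ffunMzE ffunE mulrzz mulrC. Qed.

Lemma arc_coord_exists : exists f : Defs.arc D -> 'I_n * ivec n,
  forall a i x, sval a (i, x) -> ceq L (f a) (i, height i x).
Proof.
exists (fun a => let p := projT1 (cid (arc_pos a)) in (p.1, height p.1 p.2)) => a i x.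
case: cid => -[j y] /= ay /(arc_mem ay)[/= e [m F]]; split=> //=.
by rewrite (height_free F) -e height_shift addrAC subrr add0r; apply: stabv_turn.
Qed.

Definition arc_coord : Defs.arc D -> 'I_n * ivec n := projT1 (cid arc_coord_exists).

Lemma arc_coordP a i x : sval a (i, x) -> ceq L (arc_coord a) (i, height i x).
Proof. exact: (projT2 (cid arc_coord_exists)). Qed.

Lemma arc_coord_rel s t : @link_relation _ D s t ->
  ceq L (eval_term arc_coord s) (eval_term arc_coord t).
Proof.
move=> /link_relation_inv[i [c [x [x' [a [a' [a1 [cP ax ax' a1c E]]]]]]]].
have a1E : (arc_coord a1).1 = c.1.1.
  by have [] := @arc_coordP a1 c.1.1 c.1.2; rewrite -?surjective_pairing.
have h := arc_coordP ax; have h' := arc_coordP ax'; rewrite (height_single_underpass cP) in h'.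
case: (writhe_cases c) => w; rewrite w in E h'; case: E => -> -> /=; rewrite a1E.
  by apply: ceq_trans h' (ceq_sym _); apply: ceqD h.
apply: (ceq_trans h); apply: ceq_sym.
have := ceqD (unitv c.1.1) h'; rewrite mulrNz subrK; exact.
Qed.

Definition link_coord : Q -> 'I_n * ivec n := @pres_coord _ _ (@link_relation _ D) arc_coord.

Definition tc_coord : T -> 'I_n * ivec n := @pres_coord _ _ (@tc_relation Q) link_coord.

Lemma link_coord_op x y :
  ceq L (link_coord (qop x y)) ((link_coord x).1, (link_coord x).2 + unitv (link_coord y).1).
Proof. exact: (pres_coord_op arc_coord_rel). Qed.

Lemma tc_coord_op x y :
  ceq L (tc_coord (qop x y)) ((tc_coord x).1, (tc_coord x).2 + unitv (tc_coord y).1).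
Proof. exact: (pres_coord_op (tc_coord_rel link_coord_op)). Qed.

Definition arc_class (a : Defs.arc D) : T :=
  tc_class (presented_class (@link_relation _ D) (TGen a) : Q).

Lemma arc_class_single_underpass i c x x' (a a' a1 : Defs.arc D) : single_underpass i c x x' ->
  sval a (i, x) -> sval a' (i, x') -> sval a1 c.1 ->
  (writhe c = 1 -> arc_class a' = qop (arc_class a) (arc_class a1)) /\
  (writhe c = -1 -> arc_class a = qop (arc_class a') (arc_class a1)).
Proof.
move=> cP ax ax' a1c; have := link_relation_single_underpass cP ax ax' a1c.
by rewrite /arc_class -!tc_classM !presented_qopE => r; split=> w; rewrite w in r;
  congr tc_class; apply/presented_classP/qeq_rel.
Qed.

Definition start i : R := sval (cid2 (@not_underpass_near i 0 1 ltr01)).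

Lemma startP i : ~ @underpass _ D (i, start i).
Proof. by rewrite /start; case: cid2. Qed.

Definition start_class i : T := arc_class (projT1 (cid (arc_exists (@startP i)))).

Local Notation tact := (act (@tc_inv Q) start_class).
Let tactD := actD (@tc_invK Q) (@tc_opK Q) (@tc_opAC Q) start_class.
Let tact0 := act0 (@tc_inv Q) start_class.
Let tact_unit := act_unit (@tc_invK Q) (@tc_opK Q) (@tc_opAC Q) start_class.
Let top_op := op_op (@tc_opK Q) (@tc_opAC Q).
Let top_act := op_act (@tc_invK Q) (@tc_opK Q) (@tc_opAC Q) start_class.

(** The arcs of a component are translates of each other, so they act alike.
    In [arc_classE] this replaces translations by overpassing arcs by translations
    by the [start_class] of their components. *)
Lemma op_arc_class z i x a : sval a (i, x) ->
  qop z (arc_class a) = qop z (start_class i).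
Proof.
move=> ax; rewrite /start_class; case: cid => b /= bx.
suff P : forall x a, sval a (i, x) -> qop z (arc_class a) = qop z (arc_class b) by apply: P ax.
move=> {a ax} y a ay.
pose P y := forall a, sval a (i, y) -> qop z (arc_class a) = qop z (arc_class b).
apply: (@component_walk i P _ _ (start i) y) => //.
- by move=> u u' F Pu d du; apply/Pu/(arc_free du)/free_sym.
- move=> c u u' cP nu nu'.
  have [d du] := arc_exists nu; have [d' du'] := arc_exists nu'.
  have [a1 a1c] : exists a1 : Defs.arc D, sval a1 c.1.
    by apply: arc_exists; apply: overpass_not_underpass; case: cP.
  have E : qop z (arc_class d) = qop z (arc_class d').
    have [Ep En] := arc_class_single_underpass cP du du' a1c.
    by case: (writhe_cases c) => [/Ep|/En] ->; rewrite top_op.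
  split=> H e eu; first by rewrite (arc_unique eu du') -E; apply: H.
  by rewrite (arc_unique eu du) E; apply: H.
- exact: startP.
- exact: arc_not_underpass ay.
- by move=> d du; rewrite (arc_unique du bx).
Qed.

(** The element at height [0], which need not be the class of an arc. *)
Definition origin i : T := tact (- height i (start i)) (start_class i).

Lemma arc_classE a i x : sval a (i, x) -> arc_class a = tact (height i x) (origin i).
Proof.
move=> ax; pose P y := forall a, sval a (i, y) -> arc_class a = tact (height i y) (origin i).
apply: (@component_walk i P _ _ (start i) x) => //.
- by move=> u u' F Pu d du; rewrite -(height_free F); apply/Pu/(arc_free du)/free_sym.
- move=> c u u' cP nu nu'.
  have [d du] := arc_exists nu; have [d' du'] := arc_exists nu'.
  have [a1 a1c] : exists a1 : Defs.arc D, sval a1 c.1.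
    by apply: arc_exists; apply: overpass_not_underpass; case: cP.
  have a1E z : qop z (arc_class a1) = qop z (start_class c.1.1).
    by apply: (@op_arc_class _ _ c.1.2); rewrite -surjective_pairing.
  have [Ep En] := arc_class_single_underpass cP du du' a1c; rewrite !a1E in Ep En.
  have := height_single_underpass cP.
  case: (writhe_cases c) => w; rewrite w ?mulrN1z ?mulr1z => hE; [have E := Ep w|have E := En w];
    split=> H e eu.
  + by rewrite (arc_unique eu du') E hE tact_unit (H _ du).
  + rewrite (arc_unique eu du); apply: (@qop_injl _ (start_class c.1.1)).
    by rewrite -E -tact_unit (H _ du') hE.
  + rewrite (arc_unique eu du'); apply: (@qop_injl _ (start_class c.1.1)).
    by rewrite -E -tact_unit (H _ du) hE subrK.
  + by rewrite (arc_unique eu du) E (H _ du') hE -tact_unit subrK.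
- exact: startP.
- exact: arc_not_underpass ax.
- move=> d du; rewrite /origin -tactD subrr tact0 /start_class.
  by case: cid => b /= bx; rewrite (arc_unique du bx).
Qed.

(** The parameters [start i] and [start i + 1] lie on the same arc, at heights
    that differ by [turn i]. *)
Lemma act_turn i : tact (turn i) (origin i) = origin i.
Proof.
have [a ax] := arc_exists (@startP i).
have := arc_classE (arc_shift 1 ax); rewrite (arc_classE ax) height_shift => E.
have := congr1 (tact (- height i (start i))) E.
by rewrite -!(tactD _ _ (origin i)) addNr tact0 mulr1z addKr.
Qed.

Lemma act_stabv i v : stabv L i v -> tact v (origin i) = origin i.
Proof.
move=> [k kP].
have fixU : tact (unitv i) (origin i) = origin i.
  rewrite -[unitv i]add0r tact_unit tact0.
  by rewrite -(top_act (origin i) (- height i (start i))) qop_idem.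
(* The diagonal entry, a sum over self-crossings, is corrected by [unitv i]. *)
pose m := v i - k * linking i i.
have -> : v = turn i *~ k + unitv i *~ m.
  apply/ffunP => j; rewrite ffunE !ffunMzE !ffunE !mulrzz.
  have [->|ji] := eqVneq j i; first by rewrite mul1r /m mulrC addrC subrK.
  by rewrite kP // mul0r addr0 mulrC.
have fixM := act_fixM (@tc_invK Q) (@tc_opK Q) (@tc_opAC Q).
by rewrite tactD !fixM //; apply: act_turn.
Qed.

Lemma act_coord_op v w i j :
  qop (tact v (origin i)) (tact w (origin j)) = tact (v + unitv j) (origin i).
Proof. by rewrite !top_act tact_unit. Qed.

Lemma link_coordE q : tc_class q = tact (link_coord q).2 (origin (link_coord q).1).
Proof.
rewrite /link_coord /pres_coord -{1}[q]presented_reprK;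
elim: (repr _) => [a|a IHa b IHb|a IHa b IHb] /=.
- have [[i x] ax] := arc_pos a.
  have [/= e h] := arc_coordP ax; rewrite [LHS](arc_classE ax) e; rewrite e in h.
  by rewrite -(subrK (height i x) (arc_coord a).2) [_ - _ + _]addrC tactD (act_stabv h).
- by rewrite -presented_qopE tc_classM IHa IHb act_coord_op.
- apply: (@qop_injl T (tc_class (presented_class (@link_relation _ D) b : Q))).
  rewrite {2}IHb act_coord_op subrK -IHa -tc_classM presented_qopE.
  by congr tc_class; apply/presented_classP; apply: qeq_opK.
Qed.

(** The translations commute, so an element is recovered from its coordinates by
    acting on the origin of its component; this makes the coordinates injective. *)
Lemma tc_coordE x : x = tact (tc_coord x).2 (origin (tc_coord x).1).
Proof.
rewrite /tc_coord /pres_coord -{1}[x]presented_reprK;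
elim: (repr _) => [q|a IHa b IHb|a IHa b IHb] /=.
- exact: link_coordE.
- by rewrite -presented_qopE IHa IHb act_coord_op.
- apply: (@qop_injl T (presented_class (@tc_relation Q) b)).
  rewrite {2}IHb act_coord_op subrK -IHa presented_qopE.
  by apply/presented_classP; apply: qeq_opK.
Qed.

Lemma tc_coord_arc a i x : sval a (i, x) ->
  ceq L (tc_coord (arc_class a)) (i, height i x).
Proof.
move=> ax; apply: ceq_trans (arc_coordP ax).
apply: ceq_trans (pres_coord_class (tc_coord_rel link_coord_op) _) _.
exact: (pres_coord_class arc_coord_rel).
Qed.

Theorem link_coordinatized : coordinatized L tc_coord.
Proof.
split; first exact: tc_coord_op.
  move=> x y [e h]; rewrite (tc_coordE x) (tc_coordE y) -e.
  by rewrite -(subrK (tc_coord y).2 (tc_coord x).2) [_ - _ + _]addrC tactD (act_stabv h).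
move=> [i v]; have [a ax] := arc_exists (@startP i).
have Ta := tc_coord_arc ax; rewrite -(subrK (height i (start i)) v).
elim/ivec_ind: {v}(v - _) => [|v j]; first by exists (arc_class a); rewrite add0r.
have [b bx] := arc_exists (@startP j); have [bj _] := tc_coord_arc bx.
rewrite addrAC; split=> -[x xP].
  exists (qop x (arc_class b)); apply: ceq_trans (tc_coord_op _ _) _.
  by rewrite bj; apply: ceqD xP.
exists (tc_inv x (arc_class b)).
have := tc_coord_op (tc_inv x (arc_class b)) (arc_class b); rewrite tc_opK bj => h.
have := ceqD (- unitv j) (ceq_trans (ceq_sym h) xP); rewrite /= !addrK.
by rewrite -surjective_pairing.
Qed.

End Arcs.

(** * Discrete winding numbers *)

Section RayCrossing.
Variable R : realType.
Local Notation vec := (R * R)%type.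
Local Notation cross := (@cross_product R).

(** The sign with which the segment from [p] to [q] crosses the positive
    horizontal axis, counted upwards.  The points of the axis belong to the upper
    side, so that concatenated segments are counted consistently. *)
Definition ray_crossing (p q : vec) : int :=
  if [&& p.2 < 0, 0 <= q.2 & 0 < cross p q] then 1
  else if [&& q.2 < 0, 0 <= p.2 & cross p q < 0] then -1 else 0.

Definition half_plane (v p : vec) : Prop := 0 < cross v p.

(** On the half-plane of [v], the jump function of the ray: it can be nonzero only
    if that half-plane contains the ray, that is if [v.2 < 0]. *)
Definition side (v p : vec) : int := ((v.2 < 0) && (0 <= p.2))%:Z.

(** An open half-plane meets at most one of the two halves of the horizontal axis:
    in it, either all crossings of the axis are crossings of the ray, or none is. *)
Lemma ray_crossing_half_plane v p q : half_plane v p -> half_plane v q ->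
  ray_crossing p q = side v q - side v p.
Proof.
rewrite /half_plane /ray_crossing /side /cross_product => vp vq.
have E : (v.1 * p.2 - v.2 * p.1) * q.2 - (v.1 * q.2 - v.2 * q.1) * p.2
         = - v.2 * (p.1 * q.2 - p.2 * q.1) by ring.
set c := p.1 * q.2 - _ in E *.
have [p0|p0] := ltP p.2 0; have [q0|q0] := ltP q.2 0; rewrite ?andbF ?andbT //=.
- have : 0 < - v.2 * c by rewrite -E; nra.
  have [v0|v0] := ltP v.2 0 => h.
    by have -> : 0 < c by nra.
  by have -> : (0 < c) = false by apply/negbTE; rewrite -leNgt; nra.
- have : - v.2 * c < 0 by rewrite -E; nra.
  have [v0|v0] := ltP v.2 0 => h.
    by have -> : c < 0 by nra.
  by have -> : (c < 0) = false by apply/negbTE; rewrite -leNgt; nra.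
- by rewrite subrr.
Qed.

(** Satisfied by [bl = w - v], [br = v + w], [tr = v - w], [tl = - v - w] if
    [cross v w] is positive, and by their opposites if it is negative.  Only the
    half-planes of the sides of this parallelogram are recorded, because they
    survive small perturbations and subdivisions of the sides. *)
Definition around (v w bl br tr tl : vec) : Prop :=
  [/\ half_plane v bl /\ half_plane v br, half_plane (- w) br /\ half_plane (- w) tr,
      half_plane (- v) tr /\ half_plane (- v) tl & half_plane w tl /\ half_plane w bl].

(** The number of turns of a closed polygon whose four sides lie in the four
    half-planes of [around]. *)
Definition contour (v w bl br tr tl : vec) : int :=
  (side v br - side v bl) + (side (- w) tr - side (- w) br)
  + (side (- v) tl - side (- v) tr) + (side w bl - side w tl).

Lemma around_turn v w bl br tr tl :
  around v w bl br tr tl -> around (- w) v br tr tl bl.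
Proof. by rewrite /around opprK => -[*]. Qed.

Lemma contour_turn v w bl br tr tl :
  contour (- w) v br tr tl bl = contour v w bl br tr tl.
Proof. by rewrite /contour opprK; ring. Qed.

Lemma cross_turn v w : cross (- w) v = cross v w.
Proof. by rewrite /cross_product /=; ring. Qed.

Lemma contour_quadrant v w bl br tr tl : around v w bl br tr tl ->
  0 < cross v w -> v.2 < 0 -> w.2 <= 0 -> contour v w bl br tr tl = -1.
Proof.
rewrite /around /half_plane /contour /side.
case=> [[vbl vbr] [wbr wtr] [vtr vtl] [wtl wbl]] D v0 w0; rewrite /= !oppr_lt0.
rewrite v0 (lt_gtF v0) (le_gtF w0) /=.
have E p : cross v w * p.2 = w.2 * cross v p - v.2 * cross w p.
  by rewrite /cross_product; ring.
have crossN u p : cross (- u) p = - cross u p by rewrite /cross_product /=; ring.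
rewrite !crossN !oppr_gt0 in wbr wtr vtr vtl.
have -> : (0 <= br.2) = false.
  apply/negbTE; rewrite -ltNge -(pmulr_rlt0 _ D) E.
  have := mulr_le0_ge0 w0 (ltW vbr).
  have : 0 < v.2 * cross w br by rewrite nmulr_rgt0.
  lra.
move: w0; rewrite le_eqVlt => /predU1P[w0|w0].
  have -> : 0 <= bl.2.
    rewrite -(pmulr_rge0 _ D) E w0 mul0r sub0r oppr_ge0 nmulr_rle0 //; exact: ltW.
  by rewrite w0 ltxx.
rewrite w0 /=; have -> : 0 <= tl.2; last by case: (0 <= bl.2).
rewrite -(pmulr_rge0 _ D) E subr_ge0.
have : v.2 * cross w tl < 0 by rewrite nmulr_rlt0.
have : 0 < w.2 * cross v tl by rewrite nmulr_rgt0.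
lra.
Qed.

(** Quarter turns of the parallelogram reduce all positions of [v] and [w]
    relative to the ray to those of one quadrant. *)
Lemma contour_positive v w bl br tr tl : around v w bl br tr tl ->
  0 < cross v w -> contour v w bl br tr tl = -1.
Proof.
move=> h D.
have h1 := around_turn h; have h2 := around_turn h1; have h3 := around_turn h2.
rewrite !opprK in h2 h3.
have C1 := contour_turn v w bl br tr tl.
have := contour_turn (- w) v br tr tl bl; rewrite C1 => C2.
have := contour_turn (- v) (- w) tr tl bl br; rewrite C2 opprK => C3.
have X2 : cross (- v) (- w) = cross v w by rewrite /cross_product /=; ring.
have X3 : cross w (- v) = cross v w by rewrite /cross_product /=; ring.
have [v0|v0|v0] := ltgtP v.2 0.
- have [w0|w0] := leP w.2 0; first exact: contour_quadrant.
  by rewrite -C1 contour_quadrant // ?cross_turn //= ?oppr_lt0 // ltW.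
- have [w0|w0] := ltP w.2 0.
    by rewrite -C3 contour_quadrant ?X3 //= oppr_le0 ltW.
  by rewrite -C2 contour_quadrant ?X2 //= ?oppr_lt0 ?oppr_le0.
- have [w0|w0|w0] := ltgtP w.2 0.
  + by rewrite -C3 contour_quadrant ?X3 //= oppr_le0 v0.
  + by rewrite -C1 contour_quadrant // ?cross_turn //= ?oppr_lt0 // v0.
  + by move: D; rewrite /cross_product v0 w0 mulr0 mul0r subr0 ltxx.
Qed.

(** Exchanging the two directions reverses the orientation of the contour. *)
Lemma contour_swap v w bl br tr tl :
  contour w v bl tl tr br = - contour v w bl br tr tl.
Proof. by rewrite /contour; ring. Qed.

Lemma contour_sign v w bl br tr tl : around v w bl br tr tl -> cross v w != 0 ->
  contour v w bl br tr tl = if 0 < cross v w then -1 else 1.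
Proof.
move=> h D0; have [D|D|/eqP] := ltgtP 0 (cross v w); last by rewrite eq_sym (negPf D0).
  exact: contour_positive.
apply: oppr_inj; rewrite -contour_swap; apply: contour_positive.
  by case: h => -[? ?] [? ?] [? ?] [? ?].
have -> : cross w v = - cross v w by rewrite /cross_product; ring.
by rewrite oppr_gt0.
Qed.

End RayCrossing.

Section Grid.
Variables (R : realType) (F : nat -> nat -> R * R).

Definition hedge a b := ray_crossing (F a b) (F a.+1 b).
Definition vedge a b := ray_crossing (F a b) (F a b.+1).

Definition cell a b : int := (hedge a b - hedge a b.+1) + (vedge a.+1 b - vedge a b).

Lemma cell_half_plane v a b : half_plane v (F a b) -> half_plane v (F a.+1 b) ->
  half_plane v (F a b.+1) -> half_plane v (F a.+1 b.+1) -> cell a b = 0.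
Proof.
move=> h00 h10 h01 h11; rewrite /cell /hedge /vedge.
by rewrite !(@ray_crossing_half_plane _ v) //; ring.
Qed.

(** Edges inside the rectangle are shared by two cells and cancel. *)
Lemma sum_cells a0 a1 b0 b1 : (a0 <= a1)%N -> (b0 <= b1)%N ->
  \sum_(a0 <= a < a1) \sum_(b0 <= b < b1) cell a b =
  \sum_(a0 <= a < a1) (hedge a b0 - hedge a b1) +
  \sum_(b0 <= b < b1) (vedge a1 b - vedge a0 b).
Proof.
move=> a01 b01; rewrite /cell; under eq_bigr do rewrite big_split /=.
rewrite big_split /=; congr (_ + _).
  apply: eq_bigr => a _; rewrite -[RHS]opprB -telescope_sumr // -sumrN.
  by apply: eq_bigr => b _; rewrite opprB.
by rewrite exchange_big /=; apply: eq_bigr => b _; rewrite telescope_sumr.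
Qed.

Lemma sum_cells_periodic N : (forall b, F N b = F 0 b) -> (forall a, F a N = F a 0) ->
  \sum_(0 <= a < N) \sum_(0 <= b < N) cell a b = 0.
Proof.
move=> pa pb; rewrite sum_cells // !big1 ?addr0 // => i _.
  by rewrite /vedge !pa subrr.
by rewrite /hedge !pb subrr.
Qed.

Lemma sum_hedge v a0 a1 b : (a0 <= a1)%N ->
  (forall a, (a0 <= a <= a1)%N -> half_plane v (F a b)) ->
  \sum_(a0 <= a < a1) hedge a b = side v (F a1 b) - side v (F a0 b).
Proof.
move=> a01 h; rewrite -(telescope_sumr (fun a => side v (F a b))) //.
apply: eq_big_nat => a /andP[a0a aa1]; rewrite /hedge.
by rewrite (@ray_crossing_half_plane _ v) //; apply: h; rewrite ?a0a ?(ltnW aa1) ?leqW.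
Qed.

Lemma sum_vedge v b0 b1 a : (b0 <= b1)%N ->
  (forall b, (b0 <= b <= b1)%N -> half_plane v (F a b)) ->
  \sum_(b0 <= b < b1) vedge a b = side v (F a b1) - side v (F a b0).
Proof.
move=> b01 h; rewrite -(telescope_sumr (fun b => side v (F a b))) //.
apply: eq_big_nat => b /andP[b0b bb1]; rewrite /vedge.
by rewrite (@ray_crossing_half_plane _ v) //; apply: h; rewrite ?b0b ?(ltnW bb1) ?leqW.
Qed.

(** On each side of the block the crossings telescope within a half-plane, so only
    the four corners matter, however fine the grid is. *)
Lemma sum_block v w a0 a1 b0 b1 : (a0 <= a1)%N -> (b0 <= b1)%N -> cross_product v w != 0 ->
  (forall a, (a0 <= a <= a1)%N -> half_plane v (F a b0) /\ half_plane (- v) (F a b1)) ->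
  (forall b, (b0 <= b <= b1)%N -> half_plane w (F a0 b) /\ half_plane (- w) (F a1 b)) ->
  \sum_(a0 <= a < a1) \sum_(b0 <= b < b1) cell a b =
  if 0 < cross_product v w then -1 else 1.
Proof.
move=> a01 b01 D0 hv hw; rewrite sum_cells // !sumrB.
have va a : (a0 <= a <= a1)%N -> half_plane v (F a b0) by case/hv.
have va' a : (a0 <= a <= a1)%N -> half_plane (- v) (F a b1) by case/hv.
have wb b : (b0 <= b <= b1)%N -> half_plane w (F a0 b) by case/hw.
have wb' b : (b0 <= b <= b1)%N -> half_plane (- w) (F a1 b) by case/hw.
rewrite (sum_hedge a01 va) (sum_hedge a01 va') (sum_vedge b01 wb) (sum_vedge b01 wb').
have [lx rx] : (a0 <= a0 <= a1)%N /\ (a0 <= a1 <= a1)%N by rewrite !leqnn a01.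
have [ly ry] : (b0 <= b0 <= b1)%N /\ (b0 <= b1 <= b1)%N by rewrite !leqnn b01.
rewrite -(@contour_sign _ v w (F a0 b0) (F a1 b0) (F a1 b1) (F a0 b1)) //.
  by rewrite /contour; ring.
by split; split; auto.
Qed.

End Grid.

(** * Local and uniform estimates on two curves *)

(** Asking for all small radii, instead of one, makes the conditions stable under
    finite conjunctions. *)
Lemma common_radius (R : realType) (T : eqType) (s : seq T) (P : T -> R -> Prop) :
  (forall x, x \in s -> exists2 e, 0 < e & forall r, 0 < r <= e -> P x r) ->
  exists2 e, 0 < e & forall r, 0 < r <= e -> forall x, x \in s -> P x r.
Proof.
elim: s => [|x s IH] h; first by exists 1.
have [|e e0 eP] := IH; first by move=> y ys; apply: h; rewrite inE ys orbT.
have [d d0 dP] := h x (mem_head _ _).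
exists (Num.min e d); first by rewrite lt_min e0.
move=> r /andP[r0]; rewrite le_min => /andP[re rd] y.
rewrite inE => /predU1P[->|ys]; first by apply: dP; rewrite r0.
by apply: eP; rewrite ?r0.
Qed.

Section Tangent.
Variable R : realType.
Local Notation vec := (R * R)%type.
Local Notation cross := (@cross_product R).

(** Differentiability in each coordinate; no continuity of the derivative is
    involved, so breakpoints of the curves do not matter. *)
Definition tangent (g : R -> vec) (t : R) (v : vec) : Prop :=
  forall e, 0 < e -> exists2 d, 0 < d & forall x, `|x - t| <= d ->
    `|(g x).1 - (g t).1 - (x - t) * v.1| <= e * `|x - t| /\
    `|(g x).2 - (g t).2 - (x - t) * v.2| <= e * `|x - t|.

Lemma derivable_approx (f : R -> R) (t : R) : derivable f t 1 ->
  forall e, 0 < e -> exists2 d, 0 < d & forall x, `|x - t| <= d ->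
    `|f x - f t - (x - t) * derive1 f t| <= e * `|x - t|.
Proof.
move=> df e e0; rewrite derive1E.
have /cvgrPdist_le/(_ _ e0) :
  (fun h : R => h^-1 *: (f (h *: 1 + t) - f t)) @ 0^' --> 'D_1 f t by exact: df.
rewrite near_withinE => /nbhs_ballP[d /= d0 dP]; exists (d / 2); first lra.
move=> x xd; have [->|xt] := eqVneq x t; first by rewrite !subrr mul0r subrr normr0 mulr0.
have h0 : x - t != 0 by rewrite subr_eq0.
have := dP (x - t); rewrite /ball /= sub0r normrN => /(_ _ h0) H.
have {}H := H (le_lt_trans xd _); rewrite /GRing.scale /= mulr1 subrK in H.
have := H _; rewrite distrC => K.
have -> : f x - f t - (x - t) * 'D_1 f t = ((x - t)^-1 * (f x - f t) - 'D_1 f t) * (x - t).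
  by field.
by rewrite normrM ler_wpM2r //; apply: K; lra.
Qed.

Lemma tangent_velocity m (g : 'I_m -> R -> vec) p : has_velocity g p ->
  tangent (g p.1) p.2 (velocity g p).
Proof.
move=> [d1 d2] e e0.
have [r r0 rP] := derivable_approx d1 e0; have [q q0 qP] := derivable_approx d2 e0.
exists (Num.min r q); first by rewrite lt_min r0.
by move=> x; rewrite le_min => /andP[xr xq]; split; [apply: rP|apply: qP].
Qed.

Definition vdiff (x y : vec) : vec := (x.1 - y.1, x.2 - y.2).

Lemma linear_sign (D q c : R) : `|c| < `|q * D| ->
  (q < 0 -> 0 < D * (- q * D + c)) /\ (0 < q -> D * (- q * D + c) < 0).
Proof.
rewrite normrM ltr_norml => /andP[c1 c2].
have [D0|D0] := leP 0 D; [rewrite (ger0_norm D0) in c1 c2|rewrite (ltr0_norm D0) in c1 c2].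
  by split=> q0; [rewrite (ltr0_norm q0) in c1 c2|rewrite (gtr0_norm q0) in c1 c2]; nra.
by split=> q0; [rewrite (ltr0_norm q0) in c1 c2|rewrite (gtr0_norm q0) in c1 c2]; nra.
Qed.

Lemma cross_small (v x : vec) (m e : R) : `|v.1| + `|v.2| < m ->
  `|x.1| <= e -> `|x.2| <= e -> 0 < e -> `|cross v x| < m * e.
Proof.
move=> vm x1 x2 e0; rewrite /cross_product.
apply: le_lt_trans (ler_normB _ _) _; rewrite !normrM.
have := normr_ge0 v.1; have := normr_ge0 v.2; nra.
Qed.

(** The cross product with [v] removes the contribution of [g] to the linear part
    of [F] and leaves [- (u - u0) * D]; the remainder is small with respect to it
    where [t - t0] is not much larger than [u - u0].  Likewise for [w]. *)
Lemma zero_signs (g h : R -> vec) t0 u0 v w : g t0 = h u0 ->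
  tangent g t0 v -> tangent h u0 w -> cross v w != 0 ->
  exists2 r, 0 < r & forall t u, `|t - t0| <= r -> `|u - u0| <= r ->
  let F := vdiff (g t) (h u) in let D := cross v w in
  (`|t - t0| <= 2 * `|u - u0| ->
     (u < u0 -> 0 < D * cross v F) /\ (u0 < u -> D * cross v F < 0)) /\
  (`|u - u0| <= 2 * `|t - t0| ->
     (t < t0 -> 0 < D * cross w F) /\ (t0 < t -> D * cross w F < 0)).
Proof.
move=> E gv hw; set D := cross v w => D0.
pose m := `|v.1| + `|v.2| + `|w.1| + `|w.2| + 1.
have [nv1 nv2] := (normr_ge0 v.1, normr_ge0 v.2).
have [nw1 nw2] := (normr_ge0 w.1, normr_ge0 w.2).
have m0 : 0 < m by rewrite /m; lra.
have Dp : 0 < `|D| by rewrite normr_gt0.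
(* The factor [3] bounds [`|t - t0| + `|u - u0|] by the dominant one of the two. *)
pose e := `|D| / (3 * m).
have e0 : 0 < e by rewrite divr_gt0 // mulr_gt0.
have me : m * (e * 3) = `|D| by rewrite /e; field; apply/lt0r_neq0.
have [d d0 dP] := gv e e0.
have [d' d'0 d'P] := hw e e0.
exists (Num.min d d'); first by rewrite lt_min d0.
move=> t u; rewrite !le_min => /andP[td _] /andP[_ ud] F.
have [g1 g2] := dP _ td; have [h1 h2] := d'P _ ud.
pose x : vec := ((g t).1 - (g t0).1 - (t - t0) * v.1 - ((h u).1 - (h u0).1 - (u - u0) * w.1),
  (g t).2 - (g t0).2 - (t - t0) * v.2 - ((h u).2 - (h u0).2 - (u - u0) * w.2)).
have x1 : `|x.1| <= e * (`|t - t0| + `|u - u0|).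
  by apply: le_trans (ler_normB _ _) _; rewrite mulrDr lerD.
have x2 : `|x.2| <= e * (`|t - t0| + `|u - u0|).
  by apply: le_trans (ler_normB _ _) _; rewrite mulrDr lerD.
have Fv : cross v F = - (u - u0) * D + cross v x.
  by rewrite /F /x /D /cross_product /vdiff /= E; ring.
have Fw : cross w F = - (t - t0) * D + cross w x.
  by rewrite /F /x /D /cross_product /vdiff /= E; ring.
have bound (q : R) y : `|y.1| + `|y.2| < m -> q != 0 ->
    `|t - t0| + `|u - u0| <= 3 * `|q| -> `|cross y x| < `|q * D|.
  move=> ym q0 tu; have q1 : 0 < `|q| by rewrite normr_gt0.
  have -> : `|q * D| = m * (e * (3 * `|q|)) by rewrite normrM -me; ring.
  have ee : e * (`|t - t0| + `|u - u0|) <= e * (3 * `|q|) by rewrite ler_pM2l.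
  apply: cross_small => //; [exact: le_trans x1 ee|exact: le_trans x2 ee|].
  by rewrite mulr_gt0 // mulr_gt0.
rewrite Fv Fw; split=> le2.
  have [->|q0] := eqVneq u u0; first by split; rewrite ltxx.
  have small : `|cross v x| < `|(u - u0) * D|.
    by apply: bound; rewrite ?subr_eq0 //; rewrite /m; lra.
  by have := linear_sign small; rewrite subr_lt0 subr_gt0.
have [->|q0] := eqVneq t t0; first by split; rewrite ltxx.
have small : `|cross w x| < `|(t - t0) * D|.
  by apply: bound; rewrite ?subr_eq0 //; rewrite /m; lra.
by have := linear_sign small; rewrite subr_lt0 subr_gt0.
Qed.

End Tangent.

Section Compactness.
Variable R : realType.

Lemma lipschitz_cts (f : R -> R) (K : R) :
  (forall x y, `|f x - f y| <= K * `|x - y|) -> continuous f.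
Proof.
move=> lip x; apply/cvgrPdist_le => e e0.
have K0 : 0 < `|K| + 1 by have := normr_ge0 K; lra.
apply/nbhs_ballP; exists (e / (`|K| + 1)); first by rewrite /= divr_gt0.
move=> y; rewrite /ball /= => xy; apply: le_trans (lip _ _) _.
have KK := ler_norm K; have xy0 := normr_ge0 (x - y).
have : (`|K| + 1) * `|x - y| <= e by rewrite mulrC -ler_pdivlMr // ltW.
nra.
Qed.

Lemma square_lower_bound (f : R * R -> R) : continuous f ->
  (forall t u, 0 <= t <= 1 -> 0 <= u <= 1 -> 0 < f (t, u)) ->
  exists2 m, 0 < m & forall t u, 0 <= t <= 1 -> 0 <= u <= 1 -> m <= f (t, u).
Proof.
move=> cf f0; pose A := (`[0, 1] `*` `[0, 1])%classic : set (R * R).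
have Ane : A !=set0.
  by exists (0, 0); split; rewrite /= in_itv /= lexx ler01.
have Ac : compact A by apply: compact_setX; exact: segment_compact.
have [[t0 u0] /set_mem [/= t01 u01] mP] := compact_EVT_min Ane Ac (continuous_subspaceT cf).
rewrite /= !in_itv /= in t01 u01.
exists (f (t0, u0)); first exact: f0.
by move=> t u t1 u1; apply: mP; apply/mem_set; split; rewrite /= in_itv.
Qed.

(** Positive near [z] and zero outside a square around it. *)
Definition bump (r : R) (z p : R * R) : R :=
  Num.max 0 (r - (`|p.1 - z.1| + `|p.2 - z.2|)).

Lemma bump_continuous r z : continuous (bump r z).
Proof.
move=> p; have c0 : {for p, continuous (fun _ : R * R => 0 : R^o)} by exact: cvg_cst.
have c1 : {for p, continuous (fun q : R * R => r - (`|q.1 - z.1| + `|q.2 - z.2|) : R^o)}.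
  apply: cvgB; first exact: cvg_cst.
  apply: cvgD; apply: cvg_norm; apply: cvgB;
    [exact: cvg_fst|exact: cvg_cst|exact: cvg_snd|exact: cvg_cst].
exact: (continuous_max c0 c1).
Qed.

Lemma sum_bump_continuous r s : continuous (fun p => \sum_(z <- s) bump r z p).
Proof.
move=> p; apply: (@cvg_big _ _ (fun x y : R => x + y)); first exact: add_continuous.
by move=> z _; apply: bump_continuous.
Qed.

(** The sum of the distance and of a bump at each meeting point is positive on the
    unit square, so it has a positive minimum, and the bumps vanish at the points
    under consideration. *)
Lemma curves_apart (g h : R -> R * R) (K r : R) (zs : seq (R * R)) : 0 < r ->
  (forall x y, `|(g x).1 - (g y).1| <= K * `|x - y| /\ `|(g x).2 - (g y).2| <= K * `|x - y|) ->
  (forall x y, `|(h x).1 - (h y).1| <= K * `|x - y| /\ `|(h x).2 - (h y).2| <= K * `|x - y|) ->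
  (forall t u, 0 <= t <= 1 -> 0 <= u <= 1 -> g t = h u -> (t, u) \in zs) ->
  exists2 m, 0 < m & forall t u, 0 <= t <= 1 -> 0 <= u <= 1 ->
    (forall z, z \in zs -> r <= `|t - z.1| \/ r <= `|u - z.2|) ->
    m <= `|(g t).1 - (h u).1| + `|(g t).2 - (h u).2|.
Proof.
move=> r0 lg lh zero.
pose f p := `|(g p.1).1 - (h p.2).1| + `|(g p.1).2 - (h p.2).2|.
pose b p := \sum_(z <- zs) bump r z p.
have b0 p : 0 <= b p by apply: sumr_ge0 => z _; rewrite /bump le_max lexx.
have cf : continuous (fun p => f p + b p).
  have c1 := @lipschitz_cts (fun x => (g x).1) K (fun x y => (lg x y).1).
  have c2 := @lipschitz_cts (fun x => (g x).2) K (fun x y => (lg x y).2).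
  have d1 := @lipschitz_cts (fun x => (h x).1) K (fun x y => (lh x y).1).
  have d2 := @lipschitz_cts (fun x => (h x).2) K (fun x y => (lh x y).2).
  move=> p; apply: cvgD; last exact: sum_bump_continuous.
  apply: cvgD; apply: cvg_norm; apply: cvgB.
  - by apply: (@cvg_comp _ _ _ fst (fun x => (g x).1)); [exact: cvg_fst|exact: c1].
  - by apply: (@cvg_comp _ _ _ snd (fun x => (h x).1)); [exact: cvg_snd|exact: d1].
  - by apply: (@cvg_comp _ _ _ fst (fun x => (g x).2)); [exact: cvg_fst|exact: c2].
  - by apply: (@cvg_comp _ _ _ snd (fun x => (h x).2)); [exact: cvg_snd|exact: d2].
have pf t u : 0 <= t <= 1 -> 0 <= u <= 1 -> 0 < f (t, u) + b (t, u).
  move=> t1 u1; have [E|E] := eqVneq (g t) (h u).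
    apply: ltr_wpDl; first by rewrite /f addr_ge0.
    have zz := zero _ _ t1 u1 E; rewrite /b (big_rem _ zz) /=.
    apply: ltr_pwDl; last by apply: sumr_ge0 => z _; rewrite /bump le_max lexx.
    by rewrite /bump /= !subrr normr0 addr0 subr0 lt_max r0 orbT.
  apply: ltr_pwDl => //; rewrite /f /= lt_neqAle addr_ge0 // andbT eq_sym.
  rewrite paddr_eq0 // !normr_eq0 !subr_eq0; apply: contraNN E => /andP[/eqP e1 /eqP e2].
  by rewrite [g t]surjective_pairing e1 e2 -surjective_pairing.
have [m m0 mP] := square_lower_bound cf pf; exists m => // t u t1 u1 far.
have := mP _ _ t1 u1; rewrite /b big_seq big1 ?addr0 // => z zs_z.
rewrite /bump /=; apply/max_idPl; rewrite subr_le0.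
have := normr_ge0 (t - z.1); have := normr_ge0 (u - z.2).
by case: (far _ zs_z); lra.
Qed.

End Compactness.

(** * The algebraic number of intersections of two closed curves *)

Lemma sum_nat_restrict (N a0 a1 : nat) (f : nat -> int) : (a1 <= N)%N ->
  \sum_(0 <= a < N) (if (a0 <= a < a1)%N then f a else 0) = \sum_(a0 <= a < a1) f a.
Proof.
move=> a1N; rewrite -big_mkcond /= (big_nat_widen _ _ _ _ _ a1N) /=.
rewrite (big_nat_widenl a0 0) //=; apply: eq_bigl => a.
by rewrite andbC.
Qed.

Section GridPoint.
Variable R : realType.

(** The index of the first multiple of the mesh [N%:R^-1] above [x]. *)
Definition grid_point (N : nat) (x : R) : nat := (Num.truncn (x * N%:R)).+1.

Lemma grid_pointP N x : (0 < N)%N -> 0 <= x ->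
  x < (grid_point N x)%:R / N%:R <= x + N%:R^-1.
Proof.
move=> N0 x0; have NR : 0 < N%:R :> R by rewrite ltr0n.
have xN : 0 <= x * N%:R by rewrite mulr_ge0 // ltW.
have /andP[h1 h2] := truncn_itv xN.
rewrite ltr_pdivlMr // h2 ler_pdivrMr // mulrDl mulVf ?lt0r_neq0 //.
by rewrite /grid_point -[X in X%:R]addn1 natrD lerD2r.
Qed.

End GridPoint.

(** The half-plane consists of the vectors with positive scalar product with [x]. *)
Lemma near_half_plane (R : realType) (x y : R * R) (e : R) :
  4 * e < `|x.1| + `|x.2| -> `|y.1 - x.1| <= e -> `|y.2 - x.2| <= e ->
  half_plane (x.2, - x.1) y.
Proof.
move=> xe; rewrite !ler_norml /half_plane /cross_product /= => /andP[a1 a2] /andP[b1 b2].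
have -> : x.2 * y.2 - - x.1 * y.1 = x.1 * x.1 + x.2 * x.2 + x.1 * (y.1 - x.1) + x.2 * (y.2 - x.2).
  by ring.
have n1 : x.1 * x.1 = `|x.1| * `|x.1| by rewrite -normrM ger0_norm // -expr2 sqr_ge0.
have n2 : x.2 * x.2 = `|x.2| * `|x.2| by rewrite -normrM ger0_norm // -expr2 sqr_ge0.
have m1 : - (`|x.1| * e) <= x.1 * (y.1 - x.1).
  have : `|x.1 * (y.1 - x.1)| <= `|x.1| * e.
    by rewrite normrM ler_wpM2l // ler_norml a1.
  by rewrite ler_norml => /andP[].
have m2 : - (`|x.2| * e) <= x.2 * (y.2 - x.2).
  have : `|x.2 * (y.2 - x.2)| <= `|x.2| * e.
    by rewrite normrM ler_wpM2l // ler_norml b1.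
  by rewrite ler_norml => /andP[].
have := normr_ge0 x.1; have := normr_ge0 x.2; rewrite n1 n2.
set X := `|x.1| in xe m1 m2 *; set Y := `|x.2| in xe m1 m2 *.
move: m1 m2; set p := x.1 * _; set q := x.2 * _ => m1 m2 Y0 X0.
have e0 : 0 <= e by lra.
have : 0 <= (X - Y) ^+ 2 by rewrite sqr_ge0.
have : (X + Y) * (4 * e) < (X + Y) * (X + Y) by rewrite ltr_pM2l //; lra.
rewrite expr2; nra.
Qed.

Section Intersections.
Variables (R : realType) (g h : R -> R * R) (K : R) (zs : seq (R * R)).
Variables (v w : R * R -> R * R).
Local Notation cross := (@cross_product R).

Hypothesis g1 : g 1 = g 0.
Hypothesis h1 : h 1 = h 0.
Hypothesis gK : forall x y,
  `|(g x).1 - (g y).1| <= K * `|x - y| /\ `|(g x).2 - (g y).2| <= K * `|x - y|.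
Hypothesis hK : forall x y,
  `|(h x).1 - (h y).1| <= K * `|x - y| /\ `|(h x).2 - (h y).2| <= K * `|x - y|.
Hypothesis zs_uniq : uniq zs.
Hypothesis zs_in : forall z, z \in zs -> 0 < z.1 < 1 /\ 0 < z.2 < 1.
Hypothesis zs_transverse : forall z, z \in zs ->
  [/\ g z.1 = h z.2, tangent g z.1 (v z), tangent h z.2 (w z) & cross (v z) (w z) != 0].
Hypothesis zs_all : forall t u, 0 <= t <= 1 -> 0 <= u <= 1 -> g t = h u -> (t, u) \in zs.

(** Squares of this radius lie inside the unit square, are pairwise disjoint, and
    have on their sides the signs predicted by the tangents. *)
Definition good_radius (z : R * R) (r : R) : Prop :=
  [/\ r < z.1 < 1 - r, r < z.2 < 1 - r,
   (forall z', z' \in zs -> `|z'.1 - z.1| <= 2 * r -> `|z'.2 - z.2| <= 2 * r -> z' = z) &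
   forall t u, `|t - z.1| <= r -> `|u - z.2| <= r ->
    let F := vdiff (g t) (h u) in let D := cross (v z) (w z) in
    (`|t - z.1| <= 2 * `|u - z.2| ->
     (u < z.2 -> 0 < D * cross (v z) F) /\ (z.2 < u -> D * cross (v z) F < 0)) /\
    (`|u - z.2| <= 2 * `|t - z.1| ->
     (t < z.1 -> 0 < D * cross (w z) F) /\ (z.1 < t -> D * cross (w z) F < 0))].

Lemma good_radius_exists : exists2 r, 0 < r & forall z, z \in zs -> good_radius z r.
Proof.
suff [e e0 eP] : exists2 e : R, 0 < e &
    forall r : R, 0 < r <= e -> forall z, z \in zs -> good_radius z r.
  by exists e => // z; apply: eP; rewrite e0 lexx.
apply: common_radius => z zz.
have [/andP[z10 z11] /andP[z20 z21]] := zs_in zz.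
have [E gv hw D0] := zs_transverse zz.
have [r r0 rP] := zero_signs E gv hw D0.
have [d d0 dP] : exists2 d : R, 0 < d & forall r : R, 0 < r <= d -> forall z', z' \in zs ->
    `|z'.1 - z.1| <= 2 * r -> `|z'.2 - z.2| <= 2 * r -> z' = z.
  apply: common_radius => z' _; have [->|z'z] := eqVneq z' z; first by exists 1.
  have m0 : 0 < `|z'.1 - z.1| + `|z'.2 - z.2|.
    rewrite lt_neqAle addr_ge0 // andbT eq_sym paddr_eq0 // !normr_eq0 !subr_eq0.
    apply: contraNN z'z => /andP[/eqP e1 /eqP e2].
    by rewrite [z']surjective_pairing e1 e2 -surjective_pairing.
  exists ((`|z'.1 - z.1| + `|z'.2 - z.2|) / 5) => [|q /andP[q0 qd] a b]; first lra.
  by exfalso; lra.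
pose e := Num.min (Num.min r d)
  (Num.min (Num.min (z.1 / 2) ((1 - z.1) / 2)) (Num.min (z.2 / 2) ((1 - z.2) / 2))).
exists e.
  by rewrite !lt_min r0 d0 /=; apply/andP; split; apply/andP; split; lra.
move=> q /andP[q0]; rewrite !le_min => /andP[/andP[qr qd] /andP[/andP[q1 q2] /andP[q3 q4]]].
split; try by apply/andP; split; lra.
- by apply: dP; rewrite q0.
- by move=> t u tq uq; apply: rP; [exact: le_trans tq qr|exact: le_trans uq qr].
Qed.

Section Mesh.
Variables (r m : R) (N : nat).
Hypothesis r0 : 0 < r.
Hypothesis rP : forall z, z \in zs -> good_radius z r.
Hypothesis mP : forall t u, 0 <= t <= 1 -> 0 <= u <= 1 ->
  (forall z, z \in zs -> r / 2 <= `|t - z.1| \/ r / 2 <= `|u - z.2|) ->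
  m <= `|(g t).1 - (h u).1| + `|(g t).2 - (h u).2|.
Hypothesis N0 : (0 < N)%N.
Hypothesis Nr : N%:R^-1 <= r / 2.
Hypothesis Nm : 4 * (2 * (K * N%:R^-1)) < m.

Let n : R := N%:R.

Let n0 : 0 < n. Proof. by rewrite ltr0n. Qed.

Definition mesh (a b : nat) : R * R := vdiff (g (a%:R / n)) (h (b%:R / n)).

Lemma mesh_mono a b : (a%:R / n <= b%:R / n :> R) = (a <= b)%N.
Proof. by rewrite ler_pM2r ?invr_gt0 // ler_nat. Qed.

Lemma mesh_mono_lt a b : (a%:R / n < b%:R / n :> R) = (a < b)%N.
Proof. by rewrite ltr_pM2r ?invr_gt0 // ltr_nat. Qed.

Definition lo (x : R) := grid_point N (x - r).
Definition hi (x : R) := grid_point N (x + r / 2).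

Lemma lo_hi x : r < x < 1 - r ->
  [/\ x - r < (lo x)%:R / n <= x - r / 2, x + r / 2 < (hi x)%:R / n <= x + r,
      (lo x <= hi x)%N & (hi x <= N)%N].
Proof.
move=> /andP[x1 x2].
have xl0 : 0 <= x - r by lra.
have xh0 : 0 <= x + r / 2 by have R0 := r0; lra.
have /andP := grid_pointP N0 xl0; rewrite -/(lo x) -/n => -[l1 l2].
have /andP := grid_pointP N0 xh0; rewrite -/(hi x) -/n => -[u1 u2].
have Nr' : n^-1 <= r / 2 := Nr.
split; try by apply/andP; split; lra.
  by rewrite -mesh_mono; lra.
by rewrite -mesh_mono divff ?lt0r_neq0 //; lra.
Qed.

(** The cells of the mesh around [z]: between [r / 2] and [r] beyond it on each
    side, because the mesh is not adapted to the zeros. *)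
Definition block (z : R * R) (a b : nat) : bool :=
  (lo z.1 <= a < hi z.1)%N && (lo z.2 <= b < hi z.2)%N.

Lemma block_unique z z' a b : z \in zs -> z' \in zs ->
  block z a b -> block z' a b -> z' = z.
Proof.
move=> zz zz' /andP[/andP[a1 a2] /andP[b1 b2]] /andP[/andP[a1' a2'] /andP[b1' b2']].
have [z1 z2 sep _] := rP zz; have [z1' z2' _ _] := rP zz'.
have [/andP[l _] /andP[_ u] _ _] := lo_hi z1; have [/andP[l' _] /andP[_ u'] _ _] := lo_hi z1'.
have [/andP[k _] /andP[_ v_] _ _] := lo_hi z2; have [/andP[k' _] /andP[_ v'] _ _] := lo_hi z2'.
rewrite -mesh_mono in a1; rewrite -mesh_mono in a1'.
rewrite -mesh_mono_lt in a2; rewrite -mesh_mono_lt in a2'.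
rewrite -mesh_mono in b1; rewrite -mesh_mono in b1'.
rewrite -mesh_mono_lt in b2; rewrite -mesh_mono_lt in b2'.
by apply: sep => //; rewrite ler_norml; apply/andP; split; lra.
Qed.

(** The value at one corner is longer than the mesh allows the others to deviate. *)
Lemma cell_outside a b : (a < N)%N -> (b < N)%N ->
  (forall z, z \in zs -> ~~ block z a b) -> cell mesh a b = 0.
Proof.
move=> aN bN out.
have unit_itv c : (c < N)%N -> 0 <= c%:R / n <= 1.
  move=> cN; rewrite divr_ge0 ?ler0n //= ?(ltW n0) //.
  by rewrite ler_pdivrMr // mul1r ler_nat ltnW.
have far := mP (unit_itv _ aN) (unit_itv _ bN).
have {}far : m <= `|(mesh a b).1| + `|(mesh a b).2|.
  apply: far => z zz; have [z1 z2 _ _] := rP zz.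
  have [/andP[_ l] /andP[u _] _ _] := lo_hi z1; have [/andP[_ k] /andP[q _] _ _] := lo_hi z2.
  have [|h1'] := leP (r / 2) `|a%:R / n - z.1|; first by left.
  have [|h2'] := leP (r / 2) `|b%:R / n - z.2|; first by right.
  case/negP: (out _ zz); rewrite ltr_norml in h1'; rewrite ltr_norml in h2'.
  have [/andP[c1 c2] /andP[c3 c4]] := (h1', h2').
  rewrite /block -(mesh_mono (lo _)) -(mesh_mono_lt a) -(mesh_mono (lo _)) -(mesh_mono_lt b).
  by apply/andP; split; apply/andP; split; lra.
pose e := 2 * (K * n^-1).
have close (f : R -> R * R) (c : nat) :
    (forall x y, `|(f x).1 - (f y).1| <= K * `|x - y| /\ `|(f x).2 - (f y).2| <= K * `|x - y|) ->
    (`|(f (c.+1%:R / n)).1 - (f (c%:R / n)).1| <= K * n^-1) /\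
    (`|(f (c.+1%:R / n)).2 - (f (c%:R / n)).2| <= K * n^-1).
  move=> fK; have := fK (c.+1%:R / n) (c%:R / n).
  have -> : c.+1%:R / n - c%:R / n = n^-1.
    by rewrite -mulrBl -natr1 addrAC subrr add0r mul1r.
  by rewrite [`|n^-1|]ger0_norm // invr_ge0 ltW.
have [ga1 ga2] := close g a gK; have [hb1 hb2] := close h b hK.
rewrite !ler_norml in ga1 ga2 hb1 hb2.
have [/andP[p1 p2] /andP[p3 p4]] := (ga1, ga2).
have [/andP[q1 q2] /andP[q3 q4]] := (hb1, hb2).
have xe : 4 * e < `|(mesh a b).1| + `|(mesh a b).2| by apply: lt_le_trans far.
have e0 : 0 <= K * n^-1 by lra.
apply: (@cell_half_plane _ _ ((mesh a b).2, - (mesh a b).1));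
  by apply: (near_half_plane xe); rewrite ler_norml /mesh /vdiff /= /e; apply/andP; split; lra.
Qed.

Lemma sum_block_zero z : z \in zs ->
  \sum_(lo z.1 <= a < hi z.1) \sum_(lo z.2 <= b < hi z.2) cell mesh a b =
  if 0 < cross (v z) (w z) then -1 else 1.
Proof.
move=> zz; have [z1 z2 _ sg] := rP zz; have [_ _ _ D0] := zs_transverse zz.
have [/andP[l1 l2] /andP[u1 u2] a01 _] := lo_hi z1.
have [/andP[k1 k2] /andP[q1 q2] b01 _] := lo_hi z2.
have R0 := r0; set D := cross (v z) (w z) in sg D0 *.
(* Scaling by [D] turns the signs relative to [D] into membership in half-planes. *)
pose V := (D * (v z).1, D * (v z).2); pose W := (D * (w z).1, D * (w z).2).
have VE p : cross V p = D * cross (v z) p by rewrite /V /cross_product /=; ring.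
have WE p : cross W p = D * cross (w z) p by rewrite /W /cross_product /=; ring.
have NE (y p : R * R) : cross (- y) p = - cross y p by rewrite /cross_product /=; ring.
have DE : cross V W = D * D * D by rewrite /V /W /D /cross_product /=; ring.
have DD : 0 < D * D by rewrite -expr2 exprn_even_gt0.
have -> : (0 < D) = (0 < cross V W) by rewrite DE pmulr_rgt0.
apply: sum_block => //; first by rewrite DE !mulf_neq0.
  move=> a /andP[]; rewrite -!mesh_mono => a1 a2.
  have ta : `|a%:R / n - z.1| <= r by rewrite ler_norml; apply/andP; split; lra.
  rewrite /half_plane NE !VE oppr_gt0; split.
    have e0 : (lo z.2)%:R / n - z.2 < 0 by lra.
    have eb : `|(lo z.2)%:R / n - z.2| <= r by rewrite (ltr0_norm e0); lra.
    have [S _] := sg _ _ ta eb.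
    have [|{}S _] := S; first by rewrite (ltr0_norm e0); lra.
    by apply: S; lra.
  have e0 : 0 < (hi z.2)%:R / n - z.2 by lra.
  have eb : `|(hi z.2)%:R / n - z.2| <= r by rewrite (gtr0_norm e0); lra.
  have [S _] := sg _ _ ta eb.
  have [|_ {}S] := S; first by rewrite (gtr0_norm e0); lra.
  by apply: S; lra.
move=> b /andP[]; rewrite -!mesh_mono => b1 b2.
have ub : `|b%:R / n - z.2| <= r by rewrite ler_norml; apply/andP; split; lra.
rewrite /half_plane NE !WE oppr_gt0; split.
  have e0 : (lo z.1)%:R / n - z.1 < 0 by lra.
  have eb : `|(lo z.1)%:R / n - z.1| <= r by rewrite (ltr0_norm e0); lra.
  have [_ S] := sg _ _ eb ub.
  have [|{}S _] := S; first by rewrite (ltr0_norm e0); lra.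
  by apply: S; lra.
have e0 : 0 < (hi z.1)%:R / n - z.1 by lra.
have eb : `|(hi z.1)%:R / n - z.1| <= r by rewrite (gtr0_norm e0); lra.
have [_ S] := sg _ _ eb ub.
have [|_ {}S] := S; first by rewrite (gtr0_norm e0); lra.
by apply: S; lra.
Qed.

Lemma sum_blocks : \sum_(0 <= a < N) \sum_(0 <= b < N) cell mesh a b =
  \sum_(z <- zs) \sum_(lo z.1 <= a < hi z.1) \sum_(lo z.2 <= b < hi z.2) cell mesh a b.
Proof.
have -> : \sum_(0 <= a < N) \sum_(0 <= b < N) cell mesh a b =
    \sum_(0 <= a < N) \sum_(0 <= b < N) \sum_(z <- zs) if block z a b then cell mesh a b else 0.
  apply: eq_big_nat => a /andP[_ aN]; apply: eq_big_nat => b /andP[_ bN].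
  have [/hasP[z zz zb]|/hasPn out] := boolP (has (fun z => block z a b) zs).
    rewrite (bigD1_seq z) //= zb big_seq_cond big1 ?addr0 // => z' /andP[zz' z'z].
    by case: ifP => // zb'; rewrite (block_unique zz zz' zb zb') eqxx in z'z.
  rewrite cell_outside // big_seq big1 // => z zz.
  by rewrite (negPf (out z zz)).
under eq_bigr do rewrite exchange_big.
rewrite exchange_big /= big_seq [RHS]big_seq; apply: eq_bigr => z zz.
have [z1 z2 _ _] := rP zz; have [_ _ _ aN] := lo_hi z1; have [_ _ _ bN] := lo_hi z2.
rewrite -(sum_nat_restrict _ _ aN); apply: eq_bigr => a _.
rewrite -(sum_nat_restrict _ _ bN) /block; case: ifP => aI /=; first exact: eq_bigr.
by rewrite big1.
Qed.

End Mesh.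

Theorem intersection_sum_zero :
  \sum_(z <- zs) (if 0 < cross (v z) (w z) then 1 else -1 : int) = 0.
Proof.
have [r r0 rP] := good_radius_exists.
have r20 : 0 < r / 2 by lra.
have [m m0 mP] := curves_apart r20 gK hK zs_all.
(* The mesh is to be finer than the margin of the blocks, by the first term, and
   than the distance [m] of the curves, by the second. *)
pose x := 2 / r + 8 * `|K| / m; pose N := (Num.truncn x).+1.
have x2 : 0 <= 8 * `|K| / m by rewrite divr_ge0 ?mulr_ge0 // ltW.
have x1 : 0 < 2 / r by rewrite divr_gt0.
have xN : 2 / r + 8 * `|K| / m < N%:R by apply: real_truncnS_gt; apply: num_real.
have N0 : 0 < N%:R :> R by rewrite ltr0n.
have Nr : N%:R^-1 <= r / 2.
  rewrite -[r / 2]invf_div lef_pV2 ?posrE //; lra.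
have Nm : 4 * (2 * (K * N%:R^-1)) < m.
  have -> : 4 * (2 * (K * N%:R^-1)) = (8 * K) / N%:R by ring.
  rewrite ltr_pdivrMr //; have KK := ler_norm K.
  have : 8 * `|K| / m < N%:R by lra.
  by rewrite ltr_pdivrMr //; lra.
have S0 := @sum_blocks r m N r0 rP mP isT Nr Nm.
rewrite sum_cells_periodic in S0; first last.
- by move=> a; rewrite /mesh mul0r divff ?lt0r_neq0 // h1.
- by move=> b; rewrite /mesh mul0r divff ?lt0r_neq0 // g1.
apply: oppr_inj; rewrite oppr0 [RHS]S0 -sumrN big_seq [RHS]big_seq.
apply: eq_bigr => z zz; rewrite (@sum_block_zero r N) //; by case: ifP.
Qed.

End Intersections.

(** * Lipschitz bounds for piecewise smooth closed curves *)

Section Lipschitz.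
Variable R : realType.

Definition lip_on (f : R -> R) (a b K : R) : Prop := forall s t,
  a <= s <= b -> a <= t <= b -> `|f s - f t| <= K * `|s - t|.

Lemma lip_on_le f a b K K' : K <= K' -> lip_on f a b K -> lip_on f a b K'.
Proof.
by move=> KK' fK s t sI tI; apply: le_trans (fK _ _ sI tI) _; rewrite ler_wpM2r.
Qed.

Lemma lip_on_glue f a b c K : lip_on f a b K -> lip_on f b c K -> lip_on f a c K.
Proof.
move=> fab fbc s t; wlog st : s t / s <= t => [th sI tI|/andP[as_ sc] /andP[at_ tc]].
  by have [/th|/ltW/th] := leP s t; [exact|rewrite distrC [`|s - t|]distrC; exact].
have [tb|bt] := leP t b; first by apply: fab; apply/andP; split; lra.
have [bs|sb] := leP b s; first by apply: fbc; apply/andP; split; lra.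
apply: le_trans (ler_distD (f b) _ _) _.
have h1 : `|f s - f b| <= K * `|s - b| by apply: fab; apply/andP; split; lra.
have h2 : `|f b - f t| <= K * `|b - t| by apply: fbc; apply/andP; split; lra.
apply: le_trans (lerD h1 h2) _; rewrite -mulrDr.
by rewrite !ler0_norm; [rewrite [leLHS](_ : _ = K * - (s - t)) //; ring|lra|lra|lra].
Qed.

(** Mean value theorem, with the maximum of the derivative on the segment. *)
Lemma smooth_lip_on f a b : smooth f -> a <= b -> exists K, lip_on f a b K.
Proof.
move=> fs ab.
have df t : derivable f t 1 by have := fs 0 t.
have cdf : continuous (derive1 f).
  by move=> t; apply: differentiable_continuous; apply/derivable1_diffP; have := fs 1%N t.
have cf : continuous f.
  by move=> t; apply: differentiable_continuous; apply/derivable1_diffP; exact: df.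
have cn : continuous (fun t => `|derive1 f t|) by move=> t; apply: cvg_norm; exact: cdf.
have [c _ cP] := EVT_max ab (continuous_subspaceT cn).
exists `|derive1 f c|; move=> s t; wlog st : s t / s <= t => [th sI tI|sI tI].
  by have [/th|/ltW/th] := leP s t; [exact|rewrite distrC [`|s - t|]distrC; exact].
have dd x : x \in `]s, t[ -> is_derive x 1 f (derive1 f x).
  by move=> _; rewrite derive1E; apply/derivableP.
have [d dI dE] := MVT_segment st dd (continuous_subspaceT cf).
rewrite distrC dE normrM [`|s - t|]distrC ler_wpM2r // cP //.
by move: dI sI tI; rewrite !in_itv /= => /andP[d1 d2] /andP[s1 s2] /andP[t1 t2];
  apply/andP; split; lra.
Qed.

Lemma piecewise_lip_on (g : R -> R * R) (s : seq R) (a : R) : path <%R a s ->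
  (forall k, (k < size s)%N -> exists x y : R -> R, [/\ smooth x, smooth y &
     forall t, nth 0 (a :: s) k <= t <= nth 0 s k -> g t = (x t, y t)]) ->
  exists K, lip_on (fun t => (g t).1) a (last a s) K /\ lip_on (fun t => (g t).2) a (last a s) K.
Proof.
elim: s a => [|b s IH] a /=.
  move=> _ _; exists 0; split=> x y /le_anti <- /le_anti <-; by rewrite !subrr normr0 mulr0.
move=> /andP[ab bs] pieces.
have [K [K1 K2]] := IH b bs (fun k ks => pieces k.+1 ks).
have [x [y [xs ys xyE]]] := pieces 0%N isT.
have [L Lx] := smooth_lip_on xs (ltW ab); have [M My] := smooth_lip_on ys (ltW ab).
pose C := Num.max K (Num.max L M).
have [KC LC MC] : [/\ K <= C, L <= C & M <= C] by rewrite /C !le_max !lexx !orbT.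
exists C; split; apply: (@lip_on_glue _ _ b).
- by apply: lip_on_le LC _ => s1 t1 sI tI; rewrite (xyE _ sI) (xyE _ tI); apply: Lx.
- exact: lip_on_le KC K1.
- by apply: lip_on_le MC _ => s1 t1 sI tI; rewrite (xyE _ sI) (xyE _ tI); apply: My.
- exact: lip_on_le KC K2.
Qed.

Lemma periodic_int (T : Type) (f : R -> T) : (forall t, f (t + 1) = f t) ->
  forall t (m : int), f (t + m%:~R) = f t.
Proof.
move=> per; have pos t (k : nat) : f (t + k%:R) = f t.
  by elim: k => [|k IH]; rewrite ?addr0 // -natr1 addrA per.
move=> t [k|k]; first exact: pos.
by rewrite NegzE intrN -[in RHS](subrK k.+1%:R t) pos.
Qed.

(** Two parameters can be moved by a common integer into an interval that starts
    at [0], which is covered by finitely many periods. *)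
Lemma periodic_lip (f : R -> R) K : (forall t, f (t + 1) = f t) -> lip_on f 0 1 K ->
  forall s t, `|f s - f t| <= K * `|s - t|.
Proof.
move=> per lip s t.
have lipk (k : nat) : lip_on f 0 k%:R K.
  elim: k => [|k IH].
    by move=> x y /le_anti <- /le_anti <-; rewrite !subrr normr0 mulr0.
  apply: (lip_on_glue IH) => x y; rewrite -natr1 => xI yI.
  rewrite -(periodic_int per x (- k%:Z)) -(periodic_int per y (- k%:Z)).
  have -> : x - y = (x + (- k%:Z)%:~R) - (y + (- k%:Z)%:~R) by ring.
  by apply: lip; rewrite intrN; apply/andP; split; move: xI yI;
     rewrite -pmulrn => /andP[? ?] /andP[? ?]; lra.
pose m := Num.floor (Num.min s t); pose k := (Num.truncn (Num.max s t - m%:~R)).+1.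
have lm : m%:~R <= Num.min s t by exact: floor_le.
have uk : Num.max s t - m%:~R < k%:R by apply: real_truncnS_gt; apply: num_real.
rewrite le_min in lm; have /andP[ls lt_] := lm.
rewrite ltrBlDr gt_max in uk; have /andP[us ut] := uk.
rewrite -(periodic_int per s (- m)) -(periodic_int per t (- m)).
have -> : s - t = (s + (- m)%:~R) - (t + (- m)%:~R) by ring.
by apply: (lipk k); rewrite intrN; apply/andP; split; lra.
Qed.

Lemma piecewise_smooth_lip (g : R -> R * R) : piecewise_smooth_closed g -> exists K,
  forall s t, `|(g s).1 - (g t).1| <= K * `|s - t| /\ `|(g s).2 - (g t).2| <= K * `|s - t|.
Proof.
move=> [per [s [ps last1 pieces]]].
have [|K [K1 K2]] := @piecewise_lip_on g s 0 ps.
  by move=> k /pieces[x [y [xs ys xyE]]]; exists x, y; split=> // t /xyE[].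
rewrite last1 in K1 K2; exists K => x y; split.
  by apply: (@periodic_lip (fun t => (g t).1)) => // t; rewrite per.
by apply: (@periodic_lip (fun t => (g t).2)) => // t; rewrite per.
Qed.

End Lipschitz.

(** * Symmetry of linking numbers and the classification *)

Section Unwrap.
Variables (R : realType) (a : R).

(** A parameter in the period that starts at [0], other than [a], is moved to the
    period that starts at [a] and measured from there. *)
Definition unwrap (t : R) : R := if a < t then t - a else t - a + 1.
(** The inverse of [unwrap]: back to the period that starts at [0]. *)
Definition wrap (x : R) : R := if x + a < 1 then x + a else x + a - 1.

Hypothesis a01 : 0 <= a < 1.

Lemma unwrap_itv t : 0 <= t < 1 -> t != a -> 0 < unwrap t < 1.
Proof.
move: a01 => /andP[a0 a1] /andP[t0 t1] ta; rewrite /unwrap.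
have [h|h] := ltP a t; first by apply/andP; split; lra.
have {}h : t < a by rewrite lt_neqAle ta.
by apply/andP; split; lra.
Qed.

Lemma unwrapK t : 0 <= t < 1 -> t != a -> wrap (unwrap t) = t.
Proof.
move=> /andP[t0 t1] ta; rewrite /wrap /unwrap.
have [h|h] := ltP a t; first by rewrite subrK t1.
have -> : (t - a + 1 + a < 1) = false by apply/negbTE; rewrite -leNgt; lra.
ring.
Qed.

Lemma wrap_itv x : 0 <= x <= 1 -> 0 <= wrap x < 1.
Proof.
move: a01 => /andP[a0 a1] /andP[x0 x1]; rewrite /wrap.
by have [h|h] := ltP (x + a) 1; apply/andP; split; lra.
Qed.

Lemma wrapK x : 0 <= x <= 1 -> wrap x != a -> unwrap (wrap x) = x.
Proof.
move: a01 => /andP[a0 a1] /andP[x0 x1]; rewrite /wrap /unwrap.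
have [h|h] := ltP (x + a) 1 => xa.
  have -> : a < x + a by rewrite lt_neqAle eq_sym xa; lra.
  by rewrite addrK.
have -> : (a < x + a - 1) = false by apply/negbTE; rewrite -leNgt; lra.
ring.
Qed.

Lemma wrapE x : exists m : int, wrap x = x + a + m%:~R.
Proof.
rewrite /wrap; case: ifP => _; first by exists 0; rewrite addr0.
by exists (-1).
Qed.

End Unwrap.

Lemma tangent_shift (R : realType) (g : R -> R * R) b t v :
  tangent g (t + b) v -> tangent (fun x => g (x + b)) t v.
Proof.
move=> gv e e0; have [d d0 dP] := gv e e0; exists d => // x xt.
have E : x + b - (t + b) = x - t by ring.
by have := dP (x + b); rewrite E; apply.
Qed.

Section Symmetry.
Variables (R : realType) (D : diagram R).
Hypothesis classical : is_classical D.
Local Notation cc := (classical_crossings D).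
Local Notation cross := (@cross_product R).

(** The two linking numbers collect the crossings of the two curves according to
    which one passes over, so they enter the algebraic number of intersections with
    opposite signs.  The parameters are shifted by [a] so that no crossing is on
    the boundary of the period. *)
Lemma linking_sym (i j : 'I_(ncomp D)) : i != j -> linking i j = linking j i.
Proof.
move=> ij.
have [a a01 aP] : exists2 a : R, 0 <= a < 1 & forall c, c \in cc -> c.1.2 != a /\ c.2.2 != a.
  have [e e0 eP] : exists2 e : R, 0 < e & forall r, 0 < r <= e ->
      forall c, c \in cc -> c.1.2 != r /\ c.2.2 != r.
    apply: common_radius => c _.
    have sep (x : R) : exists2 e, 0 < e & forall r, 0 < r <= e -> x != r.
      have [x0|x0] := ltP 0 x.
        by exists (x / 2) => [|r /andP[r0 rx]]; [lra|apply/negP => /eqP; lra].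
      by exists 1 => // r /andP[r0 rx]; apply/negP => /eqP; lra.
    have [e e0 eP] := sep c.1.2; have [d d0 dP] := sep c.2.2.
    exists (Num.min e d); first by rewrite lt_min e0.
    by move=> r /andP[r0]; rewrite le_min => /andP[re rd]; rewrite eP ?dP ?r0.
  exists (Num.min e (1 / 2)).
    rewrite le_min (ltW e0) gt_min; apply/andP; split; first lra.
    by apply/orP; right; lra.
  by apply: eP; rewrite lt_min e0 ge_min lexx /= divr_gt0.
(* The crossings of the two curves, with the position on the [i]-th one first. *)
pose ps := [seq (c.2, c.1) | c <- cc & (c.1.1 == j) && (c.2.1 == i)] ++
           [seq c | c <- cc & (c.1.1 == i) && (c.2.1 == j)].
pose phi (p : position R (ncomp D) * position R (ncomp D)) := (unwrap a p.1.2, unwrap a p.2.2).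
have psP p : p \in ps -> [/\ p.1.1 = i, p.2.1 = j & (p \in cc) \/ ((p.2, p.1) \in cc)].
  rewrite mem_cat map_id => /orP[/mapP[c]|]; rewrite mem_filter.
    by move=> /andP[/andP[/eqP ? /eqP ?] cD] ->; split=> //; right; rewrite -surjective_pairing.
  by move=> /andP[/andP[/eqP ? /eqP ?] cD]; split=> //; left.
have psR p : p \in ps -> [/\ 0 <= p.1.2 < 1, 0 <= p.2.2 < 1, p.1.2 != a & p.2.2 != a].
  by move=> /psP[_ _ [] cD]; have [? ?] := crossing_range cD; have [? ?] := aP _ cD.
have cur p : p \in ps -> place (@curve R D) p.1 = place (@curve R D) p.2 /\
    transverse (@curve R D) p.1 p.2.
  move=> /psP[_ _ [] cD].
    have cD' : p \in cc ++ virtual_crossings D by rewrite mem_cat cD.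
    have [_ h] := crossings_complete p.1 p.2; rewrite -surjective_pairing in h.
    by have [] := h (or_introl cD'); split=> //; apply: crossings_transverse.
  have cD' : (p.2, p.1) \in cc ++ virtual_crossings D by rewrite mem_cat cD.
  have [_ h] := crossings_complete p.1 p.2.
  have [] := h (or_intror cD'); split=> //.
  have [hv1 hv2 D0] := crossings_transverse cD'; split=> //.
  have -> : cross (velocity (@curve R D) p.1) (velocity (@curve R D) p.2) =
     - cross (velocity (@curve R D) p.2) (velocity (@curve R D) p.1).
    by rewrite /cross_product; ring.
  by rewrite oppr_eq0.
have [per_i _] := curve_smooth i; have [per_j _] := curve_smooth j.
have [K1 K1P] := piecewise_smooth_lip (curve_smooth i).
have [K2 K2P] := piecewise_smooth_lip (curve_smooth j).
pose v (z : R * R) := velocity (@curve R D) (i, wrap a z.1).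
pose w (z : R * R) := velocity (@curve R D) (j, wrap a z.2).
have wrap_i x : curve i (x + a) = curve i (wrap a x).
  by have [m ->] := wrapE a x; rewrite periodic_int.
have wrap_j x : curve j (x + a) = curve j (wrap a x).
  by have [m ->] := wrapE a x; rewrite periodic_int.
have [uc d12 inj1 inj2] := crossings_distinct D.
have phiK p : p \in ps -> (wrap a (phi p).1 = p.1.2) * (wrap a (phi p).2 = p.2.2).
  by move=> /psR[? ? ? ?]; rewrite /phi /= !unwrapK.
have key : \sum_(z <- map phi ps) (if 0 < cross (v z) (w z) then 1 else -1 : int) = 0.
  apply: (@intersection_sum_zero R (fun x => curve i (x + a)) (fun x => curve j (x + a))
            (Num.max K1 K2)).
  - by rewrite addrC per_i add0r.
  - by rewrite addrC per_j add0r.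
  - move=> x y; have [h1 h2] := K1P (x + a) (y + a).
    have E : x + a - (y + a) = x - y by ring.
    by rewrite E in h1 h2; split; [apply: le_trans h1 _|apply: le_trans h2 _];
      rewrite ler_wpM2r // le_max lexx.
  - move=> x y; have [h1 h2] := K2P (x + a) (y + a).
    have E : x + a - (y + a) = x - y by ring.
    by rewrite E in h1 h2; split; [apply: le_trans h1 _|apply: le_trans h2 _];
      rewrite ler_wpM2r // le_max lexx orbT.
  - rewrite map_inj_in_uniq; last first.
      move=> p q pP qP E; have [[p1 p2] [q1 q2]] := (phiK _ pP, phiK _ qP).
      have [pi pj _] := psP _ pP; have [qi qj _] := psP _ qP.
      rewrite [p]surjective_pairing [q]surjective_pairing.
      rewrite [p.1]surjective_pairing [q.1]surjective_pairing.
      rewrite [p.2]surjective_pairing [q.2]surjective_pairing.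
      by rewrite pi pj qi qj -p1 -p2 -q1 -q2 E.
    rewrite cat_uniq map_id filter_uniq // andbT.
    rewrite map_inj_uniq ?filter_uniq //=; last by move=> [? ?] [? ?] [-> ->].
    apply/hasPn => c; rewrite mem_filter => /andP[_ cD].
    apply/negP => /mapP[d]; rewrite mem_filter => /andP[_ dD] E.
    by have := d12 _ _ cD dD; rewrite E eqxx.
  - by move=> z /mapP[p pP ->] /=; have [? ? ? ?] := psR _ pP; split; apply: unwrap_itv.
  - move=> z /mapP[p pP ->]; have [k1 k2] := phiK _ pP.
    have [pi pj _] := psP _ pP; have [pl [hv1 hv2 D0]] := cur _ pP.
    have e1 : (i, p.1.2) = p.1 by rewrite -pi -surjective_pairing.
    have e2 : (j, p.2.2) = p.2 by rewrite -pj -surjective_pairing.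
    rewrite /v /w !k1 !k2 e1 e2; split=> //.
    + rewrite wrap_i wrap_j k1 k2.
      by move: pl; rewrite /place pi pj.
    + have [m mE] := wrapE a (phi p).1; rewrite k1 in mE.
      have -> : (fun x => curve i (x + a)) = (fun x => curve i (x + (a + m%:~R))).
        by apply/funext => x; rewrite addrA periodic_int.
      by apply: tangent_shift; rewrite addrA -mE -pi; apply: tangent_velocity.
    + have [m mE] := wrapE a (phi p).2; rewrite k2 in mE.
      have -> : (fun x => curve j (x + a)) = (fun x => curve j (x + (a + m%:~R))).
        by apply/funext => x; rewrite addrA periodic_int.
      by apply: tangent_shift; rewrite addrA -mE -pj; apply: tangent_velocity.
  - move=> t u t01 u01; rewrite wrap_i wrap_j => E.
    pose p := (i, wrap a t); pose q := (j, wrap a u).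
    have [h _] := crossings_complete p q.
    have {h} : (p, q) \in cc \/ (q, p) \in cc.
      move: h; rewrite classical !cats0; apply; split=> //; try exact: wrap_itv.
      by apply: contraNneq ij => -[->].
    move=> pq; have [ta ua] : wrap a t != a /\ wrap a u != a.
      by case: pq => /aP[].
    apply/mapP; exists (p, q); last by rewrite /phi /= !wrapK.
    rewrite mem_cat map_id mem_filter /= !eqxx; case: pq => [->|qp]; first by rewrite orbT.
    apply/orP; left; apply/mapP; exists (q, p) => //.
    by rewrite mem_filter /= !eqxx.
have sgn p : p \in ps -> cross (v (phi p)) (w (phi p)) =
    cross (velocity (@curve R D) p.1) (velocity (@curve R D) p.2).
  move=> pP; have [k1 k2] := phiK _ pP; have [pi pj _] := psP _ pP.
  by rewrite /v /w k1 k2 -{1}pi -pj -!surjective_pairing.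
move: key; rewrite big_map big_seq.
under eq_bigr => p pP do rewrite (sgn p pP).
rewrite -big_seq big_cat map_id big_map /= !big_filter /=.
rewrite /linking /linking_over => key.
apply/esym/eqP; rewrite -subr_eq0; apply/eqP; rewrite -[RHS]key addrC.
congr (_ + _); rewrite -sumrN big_seq_cond [RHS]big_seq_cond.
apply: eq_bigr => c /andP[cD _]; rewrite /writhe.
have cD' : c \in cc ++ virtual_crossings D by rewrite mem_cat cD.
have [_ _] := crossings_transverse cD'.
have -> : cross (velocity (@curve R D) c.2) (velocity (@curve R D) c.1) =
   - cross (velocity (@curve R D) c.1) (velocity (@curve R D) c.2).
  by rewrite /cross_product; ring.
by rewrite oppr_gt0; case: ltgtP.
Qed.

End Symmetry.

Theorem theorem9 (R : realType) (D D' : diagram R)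
    (hD : is_classical D) (hD' : is_classical D') :
  quandle_iso (link_quandle_tc D) (link_quandle_tc D') <->
  (ncomp D = ncomp D' /\
   exists2 s : 'I_(ncomp D) -> 'I_(ncomp D'), bijective s &
     (forall C : {set 'I_(ncomp D)}, C \in lg_components D ->
        exists2 eps : int, (eps = -1 \/ eps = 1) &
          forall i j : 'I_(ncomp D), i \in C -> i != j ->
            linking i j = eps * linking (s i) (s j)) /\
     (forall i j : 'I_(ncomp D), i \notin lg_vertices D -> i != j ->
        linking i j = linking (s i) (s j))).
Proof.
rewrite (coordinatized_iso (link_coordinatized D) (link_coordinatized D')).
split=> [[s sB sL]|[_ [s sB [sC sV]]]]; last first.
  exists s => // i; have [iV|iV] := boolP (i \in lg_vertices D); last first.
    by exists 1; [right|move=> j ji; rewrite mul1r; apply: sV; rewrite // eq_sym].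
  have [|e e1 eP] := sC [set j in lg_vertices D | connect (@lg_adj R D) i j]%SET.
    exact: imset_f.
  exists e => // j ji; apply: eP; last by rewrite eq_sym.
  by rewrite boot.finset.in_set iV connect0.
have si := bij_inj sB; split; first by have := bij_eq_card sB; rewrite !card_ord.
exists s => //; split=> [C|i j].
  case/imsetP => i0 _ ->; have [e e1 eP] := sL i0; exists e => // i j.
  rewrite !inE => /andP[_ /connectP[p pP ->]] ij {i}.
  suff P : forall k, k != last i0 p ->
      linking (last i0 p) k = e * linking (s (last i0 p)) (s k).
    by apply: P; rewrite eq_sym.
  (* Symmetry of the linking numbers forces adjacent components to have the same sign. *)
  elim: p i0 eP pP {ij} => [|y p IH] x xP //= /andP[xy pP]; apply: IH pP.
  have [e' e'1 yP] := sL y; have /andP[nxy lxy] := xy.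
  have syx : linking y x = linking x y by rewrite linking_sym // eq_sym.
  have l0 : linking x y != 0 by move: lxy; rewrite -/(linking x y) -/(linking y x) syx orbb.
  have xyE : linking x y = e * linking (s x) (s y) by apply: xP; rewrite eq_sym.
  suff -> : e = e' by [].
  have L0 : linking (s x) (s y) != 0 by apply: contraNneq l0 => L0; rewrite xyE L0 mulr0.
  apply: (mulIf L0); rewrite -xyE -syx yP //; congr (_ * _).
  by apply: linking_sym; rewrite // (inj_eq si) eq_sym.
rewrite inE => /existsPn/(_ j) + ij; rewrite /lg_adj ij /= negb_or !negbK => /andP[/eqP l0 _].
have [e e1 eP] := sL i; have lij : linking i j = 0 := l0.
have := eP j; rewrite eq_sym lij => /(_ ij)/esym/eqP; rewrite mulf_eq0 => /orP[/eqP e0|/eqP ->] //.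
by case: e1; rewrite e0.
Qed.
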